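(* Let $\ell\ge 3$ and $m>n>1$ be integers, and in the case $\ell=4$ assume additionally that $m$ or $n$ is square-free. Then there are only finitely many triples of positive integers $(r,s,t)$ such that $$P(\ell,r)=m\,P(\ell,s)=n\,P(\ell,t).$$
   Context: For integers $\ell\ge 3$ and $r\ge 1$, the $r$-th $\ell$-gonal number is $P(\ell,r)=\frac{(\ell-2)r^2-(\ell-4)r}{2}$. *)

(* Defs.v *)
From mathcomp Require Import all_boot all_order all_algebra.
From mathcomp Require Import classical_sets cardinality.

Set Implicit Arguments.
Unset Strict Implicit.
Unset Printing Implicit Defensive.

Local Open Scope ring_scope.

(* The values are in rat because in int the operation / 2 is not a division:
   2 is not a unit of int, so 2^-1 = 2 there. *)
Definition polygonal (l r : int) : rat :=
  ((l - 2) * r ^+ 2 - (l - 4) * r)%:~R / 2%:R.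

Definition squarefree (m : int) : Prop :=
  forall d : int, (d ^+ 2 %| m)%Z -> `|d| = 1.

(* Main.v *)
Require Import Defs.
From HB Require Import structures.
From mathcomp Require Import all_boot all_order all_algebra.
From mathcomp Require Import boolp classical_sets cardinality.
From mathcomp Require Import realalg.
From mathcomp Require Import zify ring lra.

(** Completing the square turns the equations into X^2 + a_i = m_i Y_i^2 for
i = 0, 1, 2, with a_0 = 0, m_0 = 1 and, when l <> 4, distinct a_i (when l = 4
they would make m and n squares). If x, y is one solution with x very large and
X, Y another one, then sqrt(X^2 + a_i) sqrt(x^2 + a_i) = m_i Y_i y_i is an
integer, so every integral linear form in these products is 0 or at least 1 in
absolute value. On the other hand, following Rickert, let lam be the divided
difference at the nodes a_i with multiplicity K, which is the sum of the residues
of p / prod (z - a_i)^K, and apply it to (N + z)^(K - 1/2) z^p with N = x^2 and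
p < 3. The three residues are sqrt(N + a_i) times rational numbers r_i of height
at most C^K N^(K - 1), whereas expanding in powers of z / N shows that
sum sqrt(N + a_i) r_i is at most C^K N^(1/2 - 2 (K - 1)). A suitable K gives a
contradiction as soon as X exceeds a bound depending on x, provided that the
form does not vanish for one of the p < 3. This holds because, K - 1/2 not
being an integer, exact differentials reduce every p to p < 3, and a divided
difference that vanishes on all multiples of a polynomial forces the latter to
vanish to order K at the nodes. *)

Set Implicit Arguments.
Unset Strict Implicit.
Unset Printing Implicit Defensive.

Import Order.TTheory GRing.Theory Num.Theory.

Local Open Scope ring_scope.
Local Open Scope classical_set_scope.

(** * Binomial coefficients with half-integral upper argument *)

Section GeneralizedBinomial.
Variable F : numFieldType.
Implicit Types (s : F) (k h j i : nat).

Definition gbin s h : F := \prod_(j < h) ((s - j%:R) / j.+1%:R).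

Lemma gbin0 s : gbin s 0 = 1.
Proof. by rewrite /gbin big_ord0. Qed.

Lemma gbinS s h : gbin s h.+1 = gbin s h * (s - h%:R) / h.+1%:R.
Proof. by rewrite /gbin big_ord_recr /= mulrA. Qed.

Lemma gbinSM s h : h.+1%:R * gbin s h.+1 = gbin s h * (s - h%:R).
Proof. by rewrite gbinS mulrC divfK // pnatr_eq0. Qed.

Lemma gbin_pascal s h : gbin (s + 1) h.+1 = gbin s h.+1 + gbin s h.
Proof.
elim: h => [|h IHh].
  by rewrite !gbinS !gbin0; field.
have h1 : h.+1%:R != 0 :> F by rewrite pnatr_eq0.
have h2 : h.+2%:R != 0 :> F by rewrite pnatr_eq0.
rewrite gbinS IHh [gbin s h.+2]gbinS [gbin s h.+1]gbinS.
move: h1 h2; rewrite -[h.+2%:R]natr1 -[h.+1%:R]natr1 => h1 h2.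
by field; rewrite h1 h2.
Qed.

(** Trinomial revision; [pade_diffE] uses it to re-expand a binomial series about another centre. *)
Lemma gbin_mul_bin s j i :
  gbin s (j + i) * 'C(j + i, j)%:R = gbin s j * gbin (s - j%:R) i.
Proof.
elim: i => [|i IHi]; first by rewrite addn0 binn gbin0.
have i1 : i.+1%:R != 0 :> F by rewrite pnatr_eq0.
have ji1 : (j + i).+1%:R != 0 :> F by rewrite pnatr_eq0.
have E : i.+1%:R * 'C((j + i).+1, j)%:R = (j + i).+1%:R * 'C(j + i, j)%:R :> F.
  rewrite -!natrM; congr _%:R.
  by rewrite -[(j + i)%N in RHS]/(j + i).+1.-1 mul_bin_down subSn ?leq_addr // addKn.
rewrite addnS !gbinS.
apply: (mulfI i1).
rewrite mulrCA E.
transitivity ((s - (j + i)%:R) * (gbin s (j + i) * 'C(j + i, j)%:R)).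
  by rewrite [LHS]mulrA divfK //; ring.
by rewrite IHi natrD [RHS]mulrC [in RHS]mulrA divfK //; ring.
Qed.

End GeneralizedBinomial.

Section HalfBinomial.
Variable F : archiRcfType.
Implicit Types k h j i M : nat.

Definition half_bin k h : F := gbin (k%:R - 2^-1) h.

Lemma half_bin0 k : half_bin k 0 = 1.
Proof. exact: gbin0. Qed.

Lemma half_bin_pascal k h : half_bin k.+1 h.+1 = half_bin k h.+1 + half_bin k h.
Proof. by rewrite /half_bin -gbin_pascal -natr1 addrAC. Qed.

Lemma half_binSM k h :
  h.+1%:R * half_bin k h.+1 = half_bin k h * (k%:R - 2^-1 - h%:R).
Proof. exact: gbinSM. Qed.

Lemma half_bin_mul_bin k j i : (j <= k)%N ->
  half_bin k (j + i) * 'C(j + i, j)%:R = half_bin k j * half_bin (k - j) i.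
Proof.
by move=> jk; rewrite /half_bin gbin_mul_bin natrB //; congr (_ * gbin _ _); ring.
Qed.

Lemma half_bin_int0 h : 4 ^+ h * half_bin 0 h = (-1) ^+ h * 'C(h.*2, h)%:R.
Proof.
elim: h => [|h IHh]; first by rewrite half_bin0 bin0.
have h1 : h.+1%:R != 0 :> F by rewrite pnatr_eq0.
apply: (mulfI h1).
rewrite mulrCA half_binSM exprS -mulrA [4 ^+ h * _]mulrA IHh exprS.
have E : h.+1%:R * 'C(h.+1.*2, h.+1)%:R
    = 2 * (h.*2.+1)%:R * 'C(h.*2, h)%:R :> F.
  rewrite -!natrM; congr _%:R.
  have E1 : (h.+1 * 'C(h.+1.*2, h.+1) = h.+1.*2 * 'C(h.*2.+1, h))%N.
    by rewrite doubleS -mul_bin_diag.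
  have E2 : (h.+1 * 'C(h.*2.+1, h) = h.*2.+1 * 'C(h.*2, h))%N.
    by rewrite -[h.*2 in RHS]/h.*2.+1.-1 mul_bin_down; congr (_ * _)%N; lia.
  rewrite E1 -muln2 -mulnA [(2 * _)%N]mulnC mulnA E2; lia.
rewrite [RHS]mulrCA E.
set c := 'C(_, _)%:R.
have -> : h.*2.+1%:R = 2 * h%:R + 1 :> F by rewrite -natr1 -muln2 natrM mulrC.
by field.
Qed.

(** For [k = 0] a central binomial coefficient appears; Pascal's rule carries integrality to larger
    [k] without enlarging the denominator. *)
Lemma half_bin_int k h : 4 ^+ h * half_bin k h \is a Num.int.
Proof.
elim: k h => [|k IHk] [|h].
- by rewrite half_bin0 mulr1 rpredX // rpred_nat.
- by rewrite half_bin_int0 rpredM ?rpredX ?rpredN ?rpred1 ?rpred_nat.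
- by rewrite half_bin0 mulr1 rpredX // rpred_nat.
- by rewrite half_bin_pascal mulrDr rpredD // exprS -mulrA rpredM // rpred_nat.
Qed.

(** For [k = 0] the ratio of consecutive coefficients is at most 1 in absolute value, and each use
    of Pascal's rule at most doubles the bound. *)
Lemma half_bin_bound k h : `|half_bin k h| <= 2 ^+ k.
Proof.
elim: k h => [|k IHk] h.
  elim: h => [|h IHh]; first by rewrite half_bin0 normr1.
  have h1 : 0 < h.+1%:R :> F by rewrite ltr0n.
  rewrite -(ler_pM2l h1) -{1}(gtr0_norm h1) -normrM half_binSM normrM.
  apply: le_trans (ler_wpM2r (normr_ge0 _) IHh) _.
  rewrite expr0 mul1r mulr1 -[h.+1%:R]natr1 mulr0n sub0r -opprD normrN.
  rewrite ger0_norm; last by rewrite addr_ge0 ?invr_ge0 ?ler0n.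
  by rewrite addrC lerD2l invf_le1 ?ler1n ?ltr0n.
case: h => [|h].
  by rewrite half_bin0 normr1 exprn_ege1 // ler1n.
rewrite half_bin_pascal exprS; apply: le_trans (ler_normD _ _) _.
by rewrite mulr_natl mulr2n lerD.
Qed.

End HalfBinomial.

(** * Truncated binomial series *)

Section BinomialSeries.
Variable F : archiRcfType.
Implicit Types (u B : F) (k h M m n : nat).

Lemma geometric_sum_le2 u n : 0 <= u -> u <= 2^-1 -> \sum_(h < n) u ^+ h <= 2.
Proof.
move=> u0 u2; elim: n => [|n IHn]; first by rewrite big_ord0 ler0n.
rewrite big_ord_recl expr0.
under eq_bigr => i _ do rewrite lift0 exprS.
rewrite -mulr_sumr; set S := \sum_(i < n) _ in IHn *.
have S0 : 0 <= S by apply: sumr_ge0 => i _; apply: exprn_ge0.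
by nra.
Qed.

Lemma horner_small (p : {poly F}) u B M : 0 <= u -> u <= 2^-1 -> 0 <= B ->
  (forall h, (h < M)%N -> p`_h = 0) -> (forall h, `|p`_h| <= B) ->
  `|p.[u]| <= 2 * B * u ^+ M.
Proof.
move=> u0 u2 B0 pM pB.
have -> : p = drop_poly M p * 'X^M.
  rewrite -{1}(poly_take_drop M p); suff -> : take_poly M p = 0 by rewrite add0r.
  apply/polyP => h; rewrite coef_take_poly coef0; case: ifP => // hM.
  exact: pM.
rewrite !hornerE normrM (ger0_norm (exprn_ge0 _ u0)).
apply: ler_wpM2r; first exact: exprn_ge0.
rewrite horner_coef; apply: le_trans (ler_norm_sum _ _ _) _.
apply: (@le_trans _ _ (\sum_(h < size (drop_poly M p)) B * u ^+ h)).
  apply: ler_sum => h _; rewrite normrM (ger0_norm (exprn_ge0 _ u0)).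
  by apply: ler_wpM2r; rewrite ?exprn_ge0 // coef_drop_poly.
rewrite -mulr_sumr mulrC; apply: ler_wpM2r => //.
exact: geometric_sum_le2.
Qed.

Definition trunc_binom M k u : F := \sum_(h < M) half_bin F k h * u ^+ h.

(** Multiplying by [1 + u] adds neighbouring coefficients, as in Pascal's rule; the subtracted term
    is the one of degree [M.+1], beyond the cut-off. *)
Lemma trunc_binomS M k u :
  trunc_binom M.+1 k.+1 u =
  (1 + u) * trunc_binom M.+1 k u - half_bin F k M * u ^+ M.+1.
Proof.
have E : trunc_binom M.+1 k u = trunc_binom M k u + half_bin F k M * u ^+ M.
  by rewrite /trunc_binom big_ord_recr.
rewrite mulrDl mul1r {2}E mulrDr mulrCA -exprS addrA addrK.
rewrite /trunc_binom !big_ord_recl !half_bin0 -addrA; congr (_ + _).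
rewrite mulr_sumr -big_split; apply: eq_bigr => h _; rewrite lift0.
by rewrite half_bin_pascal mulrDl; congr (_ + _); rewrite exprS mulrCA.
Qed.

Definition trunc_inv_sqrt M : {poly F} := \poly_(h < M) half_bin F 0 h.

Lemma trunc_inv_sqrtE M u : (trunc_inv_sqrt M).[u] = trunc_binom M 0 u.
Proof. by rewrite horner_poly. Qed.

Lemma trunc_inv_sqrt_bound M h : `|(trunc_inv_sqrt M)`_h| <= 1.
Proof.
rewrite coef_poly; case: ifP => _; last by rewrite normr0.
by have := half_bin_bound F 0 h; rewrite expr0.
Qed.

(** The differential equation of [(1 + X)^(-1/2)]: the coefficient recursion cancels every term
    below the cut-off, and the right-hand side is what remains there. *)
Lemma trunc_inv_sqrt_ode M :
  (1 + 'X) * (trunc_inv_sqrt M.+1)^`() + 2^-1 *: trunc_inv_sqrt M.+1 =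
  ((M%:R + 2^-1) * half_bin F 0 M) *: 'X^M.
Proof.
apply/polyP => h; rewrite mulrDl mul1r !coefE.
have E : half_bin F 0 h.+1 *+ h.+1 = - half_bin F 0 h * (2^-1 + h%:R).
  by rewrite -[LHS]mulr_natl half_binSM mulr0n; ring.
case: h E => [|h] E; rewrite ?mul0r ?ltnS /=.
  case: M => [|M] /=; first by rewrite mulr0n half_bin0; ring.
  by rewrite E half_bin0 mulr0; ring.
case: (ltngtP h.+1 M) => [hM|hM|hM].
- by rewrite E mulr0 -[_ *+ h.+1]mulr_natl; ring.
- by rewrite !mul0rn !mulr0 !addr0.
- by rewrite mul0rn -hM mulr1 add0r -mulr_natl; ring.
Qed.

(* The derivative of T ^ 2 (1 + X) - 1 is a multiple of T X ^ (M - 1), which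
   determines every coefficient but the constant one. *)
Lemma trunc_inv_sqrt_sqr M u : 0 <= u -> u <= 2^-1 ->
  `|trunc_binom M.+1 0 u ^+ 2 * (1 + u) - 1| <= 4 * u ^+ M.+1.
Proof.
move=> u0 u2; pose T := trunc_inv_sqrt M.+1.
pose q := T ^+ 2 * (1 + 'X) - 1.
have -> : trunc_binom M.+1 0 u ^+ 2 * (1 + u) - 1 = q.[u].
  by rewrite -trunc_inv_sqrtE !hornerE.
have dq : q^`() = (2 * ((M%:R + 2^-1) * half_bin F 0 M)) *: (T * 'X^M).
  rewrite -scalerA scalerAr -trunc_inv_sqrt_ode -/T.
  rewrite /q derivB derivM derivD !derivE subr0 add0r mulr1.
  rewrite -mul_polyC -(mul_polyC 2^-1).
  have E : 2%:P * (2^-1)%:P = 1 :> {poly F} by rewrite -polyCM mulfV ?pnatr_eq0.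
  rewrite !mulrDr [T * ((2^-1)%:P * _)]mulrCA [2%:P * (2^-1%:P * _)]mulrA E mul1r.
  by rewrite polyC_natr; ring.
have qS h : q`_h.+1 *+ h.+1 =
    2 * ((M%:R + 2^-1) * half_bin F 0 M) * (if (h < M)%N then 0 else T`_(h - M)).
  by rewrite -coef_deriv dq coefZ coefMXn.
have q0 : q`_0 = 0.
  rewrite -horner_coef0 /q !hornerE horner_coef0 coef_poly /= half_bin0.
  by rewrite expr1n subrr.
have -> : 4 * u ^+ M.+1 = 2 * 2 * u ^+ M.+1 by ring.
apply: horner_small => //.
- case=> [_|h]; first exact: q0.
  rewrite ltnS => hM; move: (qS h); rewrite hM mulr0 => /eqP.
  by rewrite mulrn_eq0 => /eqP.
case=> [|h]; first by rewrite q0 normr0.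
have h1 : 0 < h.+1%:R :> F by rewrite ltr0n.
rewrite -(ler_pM2l h1) -{1}(gtr0_norm h1) -normrM mulr_natl qS.
case: ltnP => hM; first by rewrite mulr0 normr0 mulr_ge0 // ltW.
rewrite -mulrA normrM (ger0_norm (ler0n _ 2)) [h.+1%:R * _]mulrC.
apply: ler_wpM2l => //; rewrite -mulrA normrM ger0_norm; last first.
  by rewrite addr_ge0 ?invr_ge0 ?ler0n.
apply: (@le_trans _ _ ((M%:R + 2^-1) * 1)).
  apply: ler_wpM2l; first by rewrite addr_ge0 ?invr_ge0 ?ler0n.
  rewrite normrM; have := trunc_inv_sqrt_bound M.+1 (h - M).
  have := half_bin_bound F 0 M; rewrite expr0 => b1 b2.
  by rewrite -[1]mulr1; apply: ler_pM.
rewrite mulr1 -[h.+1%:R]natr1; apply: lerD; first by rewrite ler_nat.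
by rewrite invf_le1 ?ler1n ?ltr0n.
Qed.

(** The constant term is 1 and the others contribute at most [2 * u <= 1] in absolute value. *)
Lemma trunc_binom_ge0 M u : 0 <= u -> u <= 2^-1 -> 0 <= trunc_binom M.+1 0 u.
Proof.
move=> u0 u2.
have H : `|(trunc_inv_sqrt M.+1 - 1).[u]| <= 2 * 1 * u ^+ 1.
  apply: horner_small => // h.
    by rewrite ltnS leqn0 => /eqP ->; rewrite coefB coef1 coef_poly /= half_bin0 subrr.
  rewrite coefB coef1; case: h => [|h].
    by rewrite coef_poly /= half_bin0 subrr normr0.
  by rewrite subr0 trunc_inv_sqrt_bound.
move: H; rewrite !hornerE trunc_inv_sqrtE expr1 ler_norml => /andP[H _].
lra.
Qed.

(** For [k = 0], [T ^+ 2 * y ^+ 2 - 1] is [T * y - 1] times the factor [T * y + 1 >= 1]. The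
    induction multiplies the error by [1 + u <= 3/2] and adds the cut-off term of [trunc_binomS];
    the factor 4 absorbs both. *)
Theorem trunc_binom_error M k u : 0 <= u -> u <= 2^-1 ->
  `|(1 + u) ^+ k / Num.sqrt (1 + u) - trunc_binom M.+1 k u|
  <= 4 ^+ k.+1 * u ^+ M.+1.
Proof.
move=> u0 u2; elim: k => [|k IHk].
  set y := Num.sqrt (1 + u); set T := trunc_binom _ _ _.
  have y1 : 1 <= y by rewrite -sqrtr1 ler_wsqrtr // lerDl.
  have y0 : 0 < y by apply: lt_le_trans y1.
  have yy : y ^+ 2 = 1 + u by rewrite sqr_sqrtr // addr_ge0.
  have T0 : 0 <= T by apply: trunc_binom_ge0.
  have H : `|T ^+ 2 * (1 + u) - 1| <= 4 * u ^+ M.+1 by apply: trunc_inv_sqrt_sqr.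
  rewrite expr0 expr1; apply: le_trans H.
  have -> : T ^+ 2 * (1 + u) - 1 = (T * y - 1) * (T * y + 1) by rewrite -yy; ring.
  have -> : 1 / y - T = (1 - T * y) * y^-1 by field; rewrite gt_eqF.
  rewrite !normrM distrC; apply: ler_wpM2l => //.
  have Ty : 0 <= T * y by rewrite mulr_ge0 // ltW.
  rewrite (ger0_norm (_ : 0 <= y^-1)) ?invr_ge0 ?(ltW y0) //.
  rewrite (ger0_norm (_ : 0 <= T * y + 1)) ?addr_ge0 //.
  apply: (@le_trans _ _ 1); first by rewrite invf_le1.
  by rewrite lerDr.
rewrite trunc_binomS exprS -mulrA opprB addrCA addrC -mulrBr.
apply: le_trans (ler_normD _ _) _.
rewrite normrM (ger0_norm (_ : 0 <= 1 + u)) ?addr_ge0 //.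
rewrite normrM (ger0_norm (exprn_ge0 _ u0)).
have -> : 4 ^+ k.+2 * u ^+ M.+1 = 4 * (4 ^+ k.+1 * u ^+ M.+1) by rewrite mulrA -exprS.
set e := `|_ - _| in IHk *; set p := u ^+ M.+1 in IHk *.
have p0 : 0 <= p by apply: exprn_ge0.
have b : `|half_bin F k M| <= 4 ^+ k.+1.
  apply: le_trans (half_bin_bound F k M) _.
  apply: (@le_trans _ _ (4 ^+ k)); last by rewrite ler_eXn2l // ltr1n.
  by rewrite lerXn2r // ?nnegrE ?ler0n // ler_nat.
have : `|half_bin F k M| * p <= 4 ^+ k.+1 * p by apply: ler_wpM2r.
have : 0 <= e by apply: normr_ge0.
move: IHk; set q := 4 ^+ k.+1 * p; set r := _ * p.
move=> IHk e0 rq.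
have : 0 <= (2^-1 - u) * e by rewrite mulr_ge0 // subr_ge0.
by lra.
Qed.

End BinomialSeries.

(** * Divided differences through their moments *)

Section Moments.
Variable F : archiRcfType.
Implicit Types (f : nat -> F) (p q : {poly F}) (a b : F) (s t : seq F).

(** A linear functional on polynomials is encoded by the sequence [f] of its values on the
    monomials. *)
Definition moment f p : F := \sum_(h < size p) p`_h * f h.

Lemma moment_wide n f p : (size p <= n)%N ->
  moment f p = \sum_(h < n) p`_h * f h.
Proof.
move=> pn; rewrite /moment (big_ord_widen n (fun h => p`_h * f h) pn) big_mkcond.
apply: eq_bigr => h _; case: ltnP => // hp.
by rewrite nth_default ?mul0r.
Qed.

Lemma moment_is_linear f : scalar (moment f).
Proof.
move=> c p q; pose n := maxn (size p) (size q).
have pn : (size p <= n)%N by apply: leq_maxl.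
have qn : (size q <= n)%N by apply: leq_maxr.
have cpq : (size (c *: p + q)%R <= n)%N.
  by rewrite (leq_trans (size_polyD _ _)) // geq_max qn (leq_trans (size_scale_leq _ _)).
rewrite (moment_wide f cpq) (moment_wide f pn) (moment_wide f qn) mulr_sumr -big_split; apply: eq_bigr => h _ /=.
by rewrite coefD coefZ mulrDl mulrA.
Qed.

HB.instance Definition _ f :=
  GRing.isLinear.Build F {poly F} F *%R (moment f) (moment_is_linear f).

Lemma momentXn f n : moment f 'X^n = f n.
Proof.
rewrite /moment size_polyXn big_ord_recr big1 => [|h _] /=.
  by rewrite coefXn eqxx mul1r add0r.
by rewrite coefXn ltn_eqF ?mul0r.
Qed.

Lemma moment_pow a p : moment (fun h => a ^+ h) p = p.[a].
Proof. by rewrite horner_coef. Qed.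

Lemma moment_bound f p B (C : F) : 1 <= B -> 0 <= C ->
  (forall h, `|f h| <= C * B ^+ h) ->
  `|moment f p| <= (\sum_(h < size p) `|p`_h|) * (C * B ^+ size p).
Proof.
move=> B1 C0 fB; rewrite mulr_suml; apply: le_trans (ler_norm_sum _ _ _) _.
apply: ler_sum => h _; rewrite normrM; apply: ler_wpM2l => //.
apply: le_trans (fB h) _; apply: ler_wpM2l => //.
by apply: ler_weXn2l => //; apply: ltnW.
Qed.

Lemma moment_int f p :
  p \is a polyOver Num.int_num_subdef -> (forall h, f h \is a Num.int) ->
  moment f p \is a Num.int.
Proof.
move=> /polyOverP pint fint; apply: rpred_sum => h _.
by apply: rpredM.
Qed.

(* Turns the moments of a functional mu into those of the functional nu with
   nu(1) = 0 and nu((X - a) p) = mu(p). *)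
Fixpoint next_moment a f h : F :=
  if h is h'.+1 then a * next_moment a f h' + f h' else 0.

Lemma moment_next a f p : moment (next_moment a f) (('X - a%:P) * p) = moment f p.
Proof.
rewrite -(coefK p) poly_def mulr_sumr !linear_sum; apply: eq_bigr => h _.
rewrite -scalerAr !linearZ /= momentXn; congr (_ * _).
rewrite mulrBl -exprS mul_polyC linearB linearZ /= !momentXn /=.
by rewrite addrAC subrr add0r.
Qed.

(** Evaluation at the first node, followed by one formal division by [X - b] per further node. No
    difference of nodes is inverted, so nodes may repeat and integral nodes give integral moments
    (complete homogeneous symmetric polynomials). *)
Definition divdiff s : nat -> F :=
  if s is a :: t then foldr next_moment (fun h => a ^+ h) t else fun=> 0.

Definition nodal s : {poly F} := \prod_(b <- s) ('X - b%:P).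

Lemma divdiff_nodal s p : moment (divdiff s) (nodal s * p) = 0.
Proof.
case: s => [|a t]; first by rewrite /moment big1 // => h _; rewrite mulr0.
rewrite /nodal big_cons; elim: t p => [|b t IHt] p /=.
  by rewrite moment_pow big_nil !hornerE subrr !mul0r.
rewrite big_cons mulrCA -[_ * _ * p]mulrA moment_next.
exact: IHt.
Qed.

Lemma divdiff_small s h : (h.+1 < size s)%N -> divdiff s h = 0.
Proof.
case: s => [|a t] //; rewrite /= ltnS.
elim: t h => [|b t IHt] //; elim=> [|h IHh] //= ht.
by rewrite [next_moment _ _ _]IHh ?(ltnW ht) // IHt // mulr0 addr0.
Qed.

Lemma divdiff_lead s n : size s = n.+1 -> divdiff s n = 1.
Proof.
case: s => [|a t] // [] <- /=.
elim: t => [|b t IHt] //=.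
rewrite IHt.
have := @divdiff_small [:: a, b & t] (size t) (leqnn _); rewrite /= => ->.
by rewrite mulr0 add0r.
Qed.

Lemma divdiff_low s p : (size p < size s)%N -> moment (divdiff s) p = 0.
Proof.
move=> ps; rewrite /moment big1 // => h _; rewrite divdiff_small ?mulr0 //.
exact: leq_ltn_trans (ltn_ord h) ps.
Qed.

Lemma divdiff_int s h : all [in Num.int] s -> divdiff s h \is a Num.int.
Proof.
case: s => [|a t] /=; first by rewrite rpred0.
case/andP => aint; elim: t h => [|b t IHt] h /=; first by rewrite rpredX.
case/andP => bint tint; elim: h => [|h IHh] /=; first exact: rpred0.
by rewrite rpredD ?rpredM ?IHt.
Qed.

(** Each of the two terms of the recursion takes half of [(2 * A) ^+ h.+1], so the bound is
    independent of the number of nodes. *)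
Lemma divdiff_bound s (A : F) h : 1 <= A -> (forall b, b \in s -> `|b| <= A) ->
  `|divdiff s h| <= (2 * A) ^+ h.
Proof.
move=> A1; have A0 : 0 <= A by apply: le_trans A1.
case: s => [|a t] tA /=; first by rewrite normr0 exprn_ge0 // mulr_ge0.
have aA : `|a| <= A by apply: tA; rewrite mem_head.
have {tA} : forall b, b \in t -> `|b| <= A by move=> b bt; apply: tA; rewrite inE bt orbT.
elim: t h => [|b t IHt] h tA /=.
  rewrite normrX lerXn2r ?nnegrE ?mulr_ge0 //.
  by apply: le_trans aA _; lra.
have bA : `|b| <= A by apply: tA; rewrite mem_head.
elim: h => [|h IHh] /=; first by rewrite normr0.
apply: le_trans (ler_normD _ _) _; rewrite normrM exprS.
have {}IHt : `|foldr next_moment (fun h => a ^+ h) t h| <= (2 * A) ^+ h.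
  by apply: IHt => c ct; apply: tA; rewrite inE ct orbT.
have : `|b| * `|next_moment b (foldr next_moment (fun h => a ^+ h) t) h|
    <= A * (2 * A) ^+ h by apply: ler_pM.
have : 1 * (2 * A) ^+ h <= A * (2 * A) ^+ h.
  by apply: ler_wpM2r => //; rewrite exprn_ge0 // mulr_ge0.
move: IHt; set x := `|_|; set y := _ * `|_|; set z := (2 * A) ^+ h.
by move=> *; lra.
Qed.

End Moments.

(** * The sum of the absolute values of the coefficients *)

Section Norm1.
Variable F : archiRcfType.
Implicit Types (p q u : {poly F}) (a b : F).

Definition norm1 p : F := \sum_(h < size p) `|p`_h|.

Lemma norm1_wide n p : (size p <= n)%N -> norm1 p = \sum_(h < n) `|p`_h|.
Proof.
move=> pn; rewrite /norm1 (big_ord_widen n (fun h => `|p`_h|) pn) big_mkcond.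
apply: eq_bigr => h _; case: ltnP => // hp.
by rewrite nth_default ?normr0.
Qed.

Lemma norm1_ge0 p : 0 <= norm1 p.
Proof. exact: sumr_ge0. Qed.

Lemma norm10 : norm1 0 = 0.
Proof. by rewrite /norm1 size_poly0 big_ord0. Qed.

Lemma norm1D p q : norm1 (p + q) <= norm1 p + norm1 q.
Proof.
pose n := maxn (size p) (size q).
have pn : (size p <= n)%N by apply: leq_maxl.
have qn : (size q <= n)%N by apply: leq_maxr.
rewrite (norm1_wide (size_polyD p q)) (norm1_wide pn) (norm1_wide qn) -big_split.
by apply: ler_sum => h _; rewrite coefD ler_normD.
Qed.

Lemma norm1_sum n (P : 'I_n -> {poly F}) :
  norm1 (\sum_i P i) <= \sum_i norm1 (P i).
Proof.
apply: (big_ind2 (fun p x => norm1 p <= x)); first by rewrite norm10.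
  by move=> p x q y px qy; apply: le_trans (norm1D p q) _; apply: lerD.
by [].
Qed.

Lemma norm1Z a p : norm1 (a *: p) = `|a| * norm1 p.
Proof.
rewrite (norm1_wide (size_scale_leq a p)) mulr_sumr.
by apply: eq_bigr => h _; rewrite coefZ normrM.
Qed.

Lemma norm1XnM n p : norm1 ('X^n * p) <= norm1 p.
Proof.
have pn : (size ('X^n * p)%R <= n + size p)%N.
  by rewrite (leq_trans (size_polyMleq _ _)) // size_polyXn.
rewrite (norm1_wide pn) big_split_ord /= big1 ?add0r => [|h _].
  by apply: ler_sum => h _; rewrite coefXnM ltnNge leq_addr /= addKn.
by rewrite coefXnM ltn_ord normr0.
Qed.

Lemma norm1M p q : norm1 (p * q) <= norm1 p * norm1 q.
Proof.
rewrite -{1}(coefK p) poly_def !mulr_suml; apply: le_trans (norm1_sum _) _.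
apply: ler_sum => h _; rewrite -scalerAl norm1Z; apply: ler_wpM2l => //.
exact: norm1XnM.
Qed.

Lemma norm1C a : norm1 a%:P = `|a|.
Proof. by rewrite (norm1_wide (size_polyC_leq1 a)) big_ord1 coefC. Qed.

Lemma norm1X p n : norm1 (p ^+ n) <= norm1 p ^+ n.
Proof.
elim: n => [|n IHn]; first by rewrite !expr0 (norm1C 1) normr1.
rewrite !exprS; apply: le_trans (norm1M _ _) _.
by apply: ler_wpM2l; first exact: norm1_ge0.
Qed.

Lemma norm1_XsubC a : norm1 ('X - a%:P) <= 1 + `|a|.
Proof.
apply: le_trans (norm1D _ _) _; rewrite -polyCN norm1C normrN lerD2r.
by have := norm1XnM 1 1; rewrite mulr1 expr1 (norm1C 1) normr1.
Qed.

End Norm1.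

(** * Approximate idempotents *)

Section Idempotent.
Variable F : archiRcfType.
Implicit Types (p u v : {poly F}) (k : nat).

(* The upper half of the expansion of (u + v) ^ (2 k + 1): when u + v is a
   constant c, it is 0 modulo u ^ (k + 1) and c ^ (2 k + 1) modulo v ^ (k + 1). *)
Definition upper_half k u v : {poly F} :=
  \sum_(j < k.+1) (v ^+ (k - j) * u ^+ (k.+1 + j)) *+ 'C(k.+1 + k, k.+1 + j).

Lemma dvdp_upper_half k u v : u ^+ k.+1 %| upper_half k u v.
Proof.
have -> : upper_half k u v = u ^+ k.+1 *
    \sum_(j < k.+1) (v ^+ (k - j) * u ^+ j) *+ 'C(k.+1 + k, k.+1 + j).
  rewrite mulr_sumr; apply: eq_bigr => j _.
  by rewrite exprD mulrnAr mulrCA.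
exact: dvdp_mulIl.
Qed.

Lemma dvdp_upper_half_sub k u v :
  v ^+ k.+1 %| (v + u) ^+ (k.+1 + k) - upper_half k u v.
Proof.
have -> : (v + u) ^+ (k.+1 + k) = upper_half k u v +
    v ^+ k.+1 * \sum_(j < k.+1) (v ^+ (k - j) * u ^+ j) *+ 'C(k.+1 + k, j).
  rewrite exprDn -addnS big_split_ord /= addrC mulr_sumr.
  congr (_ + _); apply: eq_bigr => j _; first by rewrite subnDl.
  rewrite mulrnAr mulrA -exprD; congr (_ ^+ _ * _ *+ _).
  by rewrite addnBA // -ltnS.
by rewrite addrC addKr dvdp_mulIl.
Qed.

Lemma upper_half_int k u v :
  u \is a polyOver Num.int_num_subdef -> v \is a polyOver Num.int_num_subdef ->
  upper_half k u v \is a polyOver Num.int_num_subdef.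
Proof.
move=> ui vi; apply: rpred_sum => j _.
by rewrite rpredMn // rpredM // rpredX.
Qed.

Lemma norm1_upper_half k u v :
  norm1 (upper_half k u v) <= (norm1 v + norm1 u) ^+ (k.+1 + k).
Proof.
rewrite exprDn -addnS big_split_ord /=; apply: (@le_trans _ _ (\sum_(j < k.+1)
    (norm1 v ^+ (k - j) * norm1 u ^+ (k.+1 + j)) *+ 'C(k.+1 + k, k.+1 + j))).
  apply: le_trans (norm1_sum _) _; apply: ler_sum => j _.
  rewrite -scaler_nat norm1Z (ger0_norm (ler0n _ _)) -[leRHS]mulr_natl.
  apply: ler_wpM2l; first exact: ler0n.
  apply: le_trans (norm1M _ _) _; apply: ler_pM; rewrite ?norm1_ge0 //; exact: norm1X.
have -> : \sum_(j < k.+1) (norm1 v ^+ (k - j) * norm1 u ^+ (k.+1 + j)) *+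
      'C(k.+1 + k, k.+1 + j) =
    \sum_(j < k.+1) (norm1 v ^+ (k.+1 + k - (k.+1 + j)) * norm1 u ^+ (k.+1 + j)) *+
      'C(k.+1 + k, k.+1 + j).
  by apply: eq_bigr => j _; rewrite subnDl.
rewrite lerDr; apply: sumr_ge0 => j _; apply: mulrn_wge0.
by apply: mulr_ge0; apply: exprn_ge0; apply: norm1_ge0.
Qed.

Lemma size_upper_half k u v d : (size u <= d.+1)%N -> (size v <= d.+1)%N ->
  (size (upper_half k u v) <= (d * (k.+1 + k)).+1)%N.
Proof.
have sX (p : {poly F}) n : (size p <= d.+1 -> size (p ^+ n) <= (d * n).+1)%N.
  move=> pd; apply: leq_trans (size_poly_exp_leq _ _) _.
  by rewrite ltnS leq_mul //; case: (size p) pd.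
move=> ud vd; apply: (leq_trans (size_sum _ _ _)); apply/bigmax_leqP => j _.
rewrite -scaler_nat; apply: leq_trans (size_scale_leq _ _) _.
apply: leq_trans (size_polyMleq _ _) _.
have := sX _ (k - j)%N vd; have := sX _ (k.+1 + j)%N ud.
have jk : (j <= k)%N by rewrite -ltnS.
have : (d * (k - j) + d * (k.+1 + j) = d * (k.+1 + k))%N by rewrite -mulnDr; congr (_ * _)%N; lia.
by lia.
Qed.

End Idempotent.

(** * Hermite interpolation at three nodes *)

Section ThreeNodes.
Variables (F : archiRcfType) (a : 'I_3 -> nat).
Hypothesis a_inj : injective a.
Implicit Types (p q : {poly F}) (i l : 'I_3) (k n : nat) (v : nat -> F).

Local Notation x i := ((a i)%:R : F).
Local Notation lin i := ('X - (x i)%:P).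

Definition node_poly : {poly F} := \prod_i lin i.

Definition nodes k : seq F := flatten (nseq k.+1 [seq x i | i : 'I_3]).

(* The coefficient of X ^ (3 k + 2) in the remainder modulo node_poly ^ (k + 1). *)
Definition lam k : {poly F} -> F := moment (divdiff (nodes k)).

HB.instance Definition _ k :=
  GRing.Linear.copy (lam k) (moment (divdiff (nodes k))).

Lemma size_nodes k : size (nodes k) = (3 * k.+1)%N.
Proof.
by rewrite size_flatten /shape map_nseq sumn_nseq size_map -cardE card_ord.
Qed.

Lemma nodal_nodes k : nodal (nodes k) = node_poly ^+ k.+1.
Proof.
rewrite /nodal /nodes; elim: k.+1 => [|n IHn] /=; first by rewrite big_nil.
by rewrite big_cat IHn exprS /= big_image.
Qed.

Lemma lam_node_poly k p : lam k (node_poly ^+ k.+1 * p) = 0.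
Proof. by rewrite -nodal_nodes; exact: divdiff_nodal. Qed.

Lemma lam_dvdp k p : node_poly ^+ k.+1 %| p -> lam k p = 0.
Proof. by move/divpK <-; rewrite mulrC lam_node_poly. Qed.

Lemma lam_low k p : (size p < 3 * k.+1)%N -> lam k p = 0.
Proof. by rewrite -size_nodes; exact: divdiff_low. Qed.

Lemma mem_nodes k b : b \in nodes k -> exists i, b = x i.
Proof.
case/flattenP => s; rewrite mem_nseq /= => /eqP -> /mapP[i _ ->].
by exists i.
Qed.

Lemma lam_int k p : p \is a polyOver Num.int_num_subdef -> lam k p \is a Num.int.
Proof.
move=> pint; apply: moment_int => // h; apply: divdiff_int.
by apply/allP => b /mem_nodes[i ->]; rewrite /= rpred_nat.
Qed.

(** The successor makes positivity immediate, as [divdiff_bound] asks for [1 <= A]. *)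
Definition max_node := (\max_i a i).+1.

Lemma lam_bound k p : `|lam k p| <= norm1 p * (2 * max_node%:R) ^+ size p.
Proof.
have m1 : 1 <= max_node%:R :> F by rewrite ler1n.
rewrite -[(_ * max_node%:R) ^+ _]mul1r; apply: moment_bound => [||h] //; first by lra.
rewrite mul1r; apply: divdiff_bound => // b /mem_nodes[i ->].
by rewrite normr_nat ler_nat ltnW // ltnS; exact: leq_bigmax.
Qed.

(** Distinct nodes give pairwise coprime powers; congruences modulo [node_poly ^+ n] can thus be
    checked one node at a time. *)
Lemma dvdp_node_poly_exp n p :
  (forall i, lin i ^+ n %| p) -> node_poly ^+ n %| p.
Proof.
move=> ip; rewrite /node_poly -prodrXl.
have : uniq (index_enum 'I_3) by rewrite index_enum_uniq.
elim: (index_enum 'I_3) => [|i r IHr] /=; first by rewrite big_nil dvd1p.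
case/andP => ir ur; rewrite big_cons Gauss_dvdp ?ip ?IHr //.
rewrite coprimep_sym big_seq; apply: (big_ind (fun q => coprimep q (lin i ^+ n))).
- exact: coprime1p.
- by move=> q1 q2 c1 c2; rewrite coprimepMl c1.
move=> l lr; apply: coprimep_expl; apply: coprimep_expr.
rewrite coprimep_XsubC2 // subr_eq0 eqr_nat; apply: contraNneq ir => e.
by rewrite (a_inj e).
Qed.

Lemma node_poly_exp_dvdp n i : lin i ^+ n %| node_poly ^+ n.
Proof.
by apply: dvdp_exp2r; rewrite /node_poly (bigD1 i) //= dvdp_mulIl.
Qed.

Definition node_prod i : F := \prod_(l | l != i) (x i - x l).
Definition Delta : F := \prod_i node_prod i.
(** This is [Delta] times the Lagrange basis polynomial of node [i], scaled so that its coefficients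
    are integers. *)
Definition cofactor_poly i : {poly F} :=
  (\prod_(l | l != i) node_prod l) *: \prod_(l | l != i) lin l.

Lemma Delta_neq0 : Delta != 0.
Proof.
apply/prodf_neq0 => i _; apply/prodf_neq0 => l li.
by rewrite subr_eq0 eqr_nat; apply: contraNneq li => /a_inj ->.
Qed.

Lemma dvdp_cofactor i l : l != i -> lin l %| cofactor_poly i.
Proof.
by move=> li; rewrite /cofactor_poly -mul_polyC dvdp_mull // (bigD1 l) //= dvdp_mulIl.
Qed.

Lemma dvdp_cofactor_sub i : lin i %| Delta%:P - cofactor_poly i.
Proof.
rewrite dvdp_XsubCl rootE !hornerE horner_prod.
under [X in _ * X]eq_bigr => l _ do rewrite !hornerE.
by rewrite mulrC /Delta (bigD1 i) //= subrr.
Qed.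

Lemma node_prod_int i : node_prod i \is a Num.int.
Proof. by apply: rpred_prod => l _; rewrite rpredB ?rpred_nat. Qed.

Lemma Delta_int : Delta \is a Num.int.
Proof. by apply: rpred_prod => i _; exact: node_prod_int. Qed.

Lemma cofactor_int i : cofactor_poly i \is a polyOver Num.int_num_subdef.
Proof.
rewrite /cofactor_poly -mul_polyC rpredM // ?polyOverC.
  by apply: rpred_prod => l _; exact: node_prod_int.
apply: rpred_prod => l _; rewrite polyOverXsubC; exact: rpred_nat.
Qed.

Lemma size_cofactor i : (size (cofactor_poly i) <= 3)%N.
Proof.
apply: leq_trans (size_scale_leq _ _) _.
rewrite -big_filter size_prod_XsubC ltnS size_filter -sum1_count sum1_card.
by rewrite cardC1 card_ord.
Qed.

(** An integral substitute for the Chinese remainder idempotent: it is [Delta ^+ (2 * k + 1)] modulo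
    [lin i ^+ k.+1], zero modulo that power at the other nodes, and its coefficients grow only
    exponentially in [k]. *)
Definition idem k i : {poly F} :=
  upper_half k (cofactor_poly i) (Delta%:P - cofactor_poly i).

Lemma idem_int k i : idem k i \is a polyOver Num.int_num_subdef.
Proof.
apply: upper_half_int; first exact: cofactor_int.
by rewrite rpredB ?cofactor_int // polyOverC Delta_int.
Qed.

Lemma dvdp_idem k i l : l != i -> lin l ^+ k.+1 %| idem k i.
Proof.
move=> li; apply: dvdp_trans (dvdp_upper_half _ _ _).
exact: dvdp_exp2r (dvdp_cofactor li).
Qed.

Lemma dvdp_idem_sub k i : lin i ^+ k.+1 %| (Delta ^+ (k.+1 + k))%:P - idem k i.
Proof.
have := dvdp_upper_half_sub k (cofactor_poly i) (Delta%:P - cofactor_poly i).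
rewrite subrK -polyC_exp; apply: dvdp_trans.
exact: dvdp_exp2r (dvdp_cofactor_sub i).
Qed.

Lemma idem_sum_mod k (q : 'I_3 -> {poly F}) i :
  lin i ^+ k.+1 %| \sum_l idem k l * q l - Delta ^+ (k.+1 + k) *: q i.
Proof.
rewrite (bigD1 i) //= addrAC; apply: dvdp_add; last first.
  apply: (big_ind (fun p => lin i ^+ k.+1 %| p)); first exact: dvdp0.
    by move=> p1 p2; exact: dvdp_add.
  by move=> l li; rewrite dvdp_mulr // dvdp_idem // eq_sym.
set c := Delta ^+ _; have -> : idem k i * q i - c *: q i = - q i * (c%:P - idem k i).
  by rewrite -mul_polyC; ring.
by rewrite dvdp_mull // dvdp_idem_sub.
Qed.

Definition taylor_sum k i v : {poly F} := \sum_(j < k.+1) v j *: lin i ^+ j.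

Lemma taylor_sum_int k i v : (forall j, (j <= k)%N -> v j \is a Num.int) ->
  taylor_sum k i v \is a polyOver Num.int_num_subdef.
Proof.
move=> vint; apply: rpred_sum => j _; have jk : (j <= k)%N by rewrite -ltnS.
rewrite -mul_polyC rpredM ?polyOverC ?vint //.
by rewrite rpredX // polyOverXsubC; exact: rpred_nat.
Qed.

Lemma size_taylor_sum k i v : (size (taylor_sum k i v) <= k.+1)%N.
Proof.
apply: (leq_trans (size_sum _ _ _)); apply/bigmax_leqP => j _.
apply: leq_trans (size_scale_leq _ _) _.
by rewrite size_exp_XsubC.
Qed.

Lemma norm1_taylor_sum k i v (M : F) : 0 <= M -> (forall j, (j <= k)%N -> `|v j| <= M) ->
  norm1 (taylor_sum k i v) <= M * (2 + x i) ^+ k.+1.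
Proof.
move=> M0 vM; have y1 : 1 <= 1 + x i by rewrite lerDl.
apply: le_trans (norm1_sum _) _.
apply: (@le_trans _ _ (M * \sum_(j < k.+1) (1 + x i) ^+ j)).
  rewrite mulr_sumr; apply: ler_sum => j _; rewrite norm1Z.
  have jk : (j <= k)%N by rewrite -ltnS.
  apply: ler_pM; rewrite ?norm1_ge0 ?vM //.
  apply: le_trans (norm1X _ _) _; apply: lerXn2r; rewrite ?nnegrE ?norm1_ge0 //.
    by apply: le_trans y1.
  by apply: le_trans (norm1_XsubC _) _; rewrite normr_nat.
apply: ler_wpM2l => //.
have -> : 2 + x i = 1 + (1 + x i) by rewrite addrA.
move: (1 + x i) y1 => y y1; elim: k.+1 => [|n IHn]; first by rewrite big_ord0.
rewrite big_ord_recr exprSr mulrDr mulr1 /=; apply: lerD => //.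
have y0 : 0 <= y by apply: le_trans y1.
apply: (@le_trans _ _ ((1 + y) ^+ n)).
  by rewrite lerXn2r ?nnegrE ?addr_ge0 // lerDr.
by rewrite -[leLHS]mulr1; apply: ler_wpM2l => //; rewrite exprn_ge0 // addr_ge0.
Qed.

Definition cofactor_norm : F := 1 + \sum_i
  (norm1 (Delta%:P - cofactor_poly i) + norm1 (cofactor_poly i)).

(** The three factors account for the norm of [idem], the norm of a Taylor sum, and the moments of a
    polynomial of size at most [8 * k.+1]. *)
Definition lam_const : F :=
  cofactor_norm ^+ 2 * (2 + max_node%:R) * (2 * max_node%:R) ^+ 8.

Lemma cofactor_norm_ge1 : 1 <= cofactor_norm.
Proof. by rewrite lerDl; apply: sumr_ge0 => l _; rewrite addr_ge0 ?norm1_ge0. Qed.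

Lemma lam_const_ge1 : 1 <= lam_const.
Proof.
have m1 : 1 <= max_node%:R :> F by rewrite ler1n.
apply: mulr_ege1; last by apply: exprn_ege1; lra.
by apply: mulr_ege1; [apply: exprn_ege1; exact: cofactor_norm_ge1 | lra].
Qed.

Lemma lam_const_bound k i n v (M : F) : (n < 3)%N -> 0 <= M ->
  (forall j, (j <= k)%N -> `|v j| <= M) ->
  `|lam k ('X^n * (idem k i * taylor_sum k i v))| <= lam_const ^+ k.+1 * M.
Proof.
move=> n3 M0 vM; set t := taylor_sum k i v.
have m1 : 1 <= max_node%:R :> F by rewrite ler1n.
have m2 : 1 <= 2 * max_node%:R :> F by lra.
have c1 := cofactor_norm_ge1.
have c0 : 0 <= cofactor_norm by apply: le_trans c1.
have sz : (size ('X^n * (idem k i * t))%R <= 8 * k.+1)%N.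
  have s1 : (size (idem k i) <= (2 * (k.+1 + k)).+1)%N.
    apply: size_upper_half; first exact: size_cofactor.
    apply: leq_trans (size_polyD _ _) _.
    rewrite geq_max size_polyN size_cofactor andbT.
    by rewrite (leq_trans (size_polyC_leq1 _)).
  have s2 := size_taylor_sum k i v.
  have s3 := size_polyMleq (idem k i) t.
  apply: leq_trans (size_polyMleq _ _) _; rewrite size_polyXn /=.
  have arith (e t' et : nat) : (e <= (2 * (k.+1 + k)).+1 -> t' <= k.+1 ->
      et <= (e + t').-1 -> n + et <= 8 * k.+1)%N by lia.
  exact: arith s1 s2 s3.
apply: le_trans (lam_bound _ _) _.
apply: (@le_trans _ _ (cofactor_norm ^+ (2 * k.+1) * (M * (2 + max_node%:R) ^+ k.+1)
    * (2 * max_node%:R) ^+ (8 * k.+1))); last first.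
  rewrite /lam_const; move: cofactor_norm (2 + _) (2 * _) => c d e.
  have E (y z t' : F) : y * (M * z) * t' = y * z * t' * M by ring.
  by rewrite 2!exprMn !exprM E.
apply: ler_pM; rewrite ?norm1_ge0 ?exprn_ge0 //; first by apply: le_trans m2.
  apply: le_trans (norm1XnM _ _) _; apply: le_trans (norm1M _ _) _.
  apply: ler_pM; rewrite ?norm1_ge0 //.
    apply: le_trans (norm1_upper_half _ _ _) _.
    apply: (@le_trans _ _ (cofactor_norm ^+ (k.+1 + k))).
      apply: lerXn2r; rewrite ?nnegrE //; first by rewrite addr_ge0 ?norm1_ge0.
      rewrite /cofactor_norm (bigD1 i) //= addrCA lerDl addr_ge0 //.
      by apply: sumr_ge0 => l _; rewrite addr_ge0 ?norm1_ge0.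
    by apply: ler_weXn2l => //; lia.
  apply: le_trans (norm1_taylor_sum _ M0 vM) _; apply: ler_wpM2l => //.
  apply: lerXn2r; rewrite ?nnegrE ?addr_ge0 // lerD2l ler_nat.
  by rewrite ltnW // ltnS; exact: leq_bigmax.
by apply: ler_weXn2l.
Qed.

End ThreeNodes.

(** * The approximating forms and their independence *)

Section PadeForms.
Variables (F : archiRcfType) (a : 'I_3 -> nat) (N : nat).
Hypothesis a_inj : injective a.
Implicit Types (p q : {poly F}) (i l : 'I_3) (k n : nat) (w : 'I_3 -> F).

Local Notation lin i := ('X - ((a i)%:R : F)%:P).
Local Notation D := (node_poly F a).
Local Notation shift := ('X + (N%:R : F)%:P).

(** For [j <= k], the [j]-th Taylor coefficient of [(N + z)^(k + 1/2)] at [a i], divided by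
    [sqrt (N + a i)] to make it rational. *)
Definition pade_coef k i j : F := half_bin F k.+1 j * (N + a i)%:R ^+ (k - j).

Definition pade_part k i : {poly F} := taylor_sum a k i (pade_coef k i).

(** The weights stay free because smallness is needed for [w i = sqrt (N + a i)], but non-vanishing
    for other weights, namely products of two square roots. *)
Definition pade_poly k w : {poly F} :=
  \sum_i w i *: (idem F a k i * pade_part k i).

Definition pade_exp k : F := k.+1%:R - 2^-1.

(** The power [(N + z)^s] satisfies [(N + z) f' = s f]; cutting its Taylor series after degree [k]
    leaves an error in degree [k] only. *)
Lemma pade_part_ode k i :
  lin i ^+ k %| shift * (pade_part k i)^`() - pade_exp k *: pade_part k i.
Proof.
set s := pade_exp k; pose v := pade_coef k i; pose L := lin i.
pose t : F := (N + a i)%:R.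
have -> : shift = L + t%:P by rewrite /L /t natrD polyCD; ring.
have dV : (pade_part k i)^`() = \sum_(j < k.+1) (v j *+ j) *: L ^+ j.-1.
  rewrite /pade_part /taylor_sum raddf_sum /=; apply: eq_bigr => j _.
  by rewrite derivZ deriv_exp derivXsubC mul1r -scalerMnr scalerMnl.
have LdV : L * (pade_part k i)^`() = \sum_(j < k.+1) (v j *+ j) *: L ^+ j.
  rewrite dV mulr_sumr; apply: eq_bigr => j _; rewrite -scalerAr -exprS.
  by case: (j : nat) => [|m] //=; rewrite mulr0n !scale0r.
have tdV : t%:P * (pade_part k i)^`() = \sum_(j < k) (v j * (s - j%:R)) *: L ^+ j.
  rewrite dV mulr_sumr big_ord_recl mulr0n scale0r mulr0 add0r.
  apply: eq_bigr => j _; rewrite lift0 /= mul_polyC scalerA; congr (_ *: _).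
  have E : (k - j)%N = (k - j.+1).+1 by rewrite subnSK.
  rewrite /v /pade_coef -/t E exprS; set T := t ^+ (k - j.+1).
  transitivity (t * T * (j.+1%:R * half_bin F k.+1 j.+1)).
    by rewrite -mulr_natl; ring.
  by rewrite half_binSM -/(pade_exp k) -/s; ring.
rewrite mulrDl LdV tdV /pade_part /taylor_sum scaler_sumr !big_ord_recr /=.
rewrite -/L -/v.
have -> : \sum_(j < k) (v j *+ j) *: L ^+ j =
    \sum_(j < k) s *: (v j *: L ^+ j) - \sum_(j < k) (v j * (s - j%:R)) *: L ^+ j.
  rewrite -sumrB; apply: eq_bigr => j _; rewrite scalerA -scalerBl.
  by congr (_ *: _); rewrite -mulr_natl; ring.
set S1 := \sum_(j < k) _ *: (_ *: _); set S2 := \sum_(j < k) _.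
have -> : S1 - S2 + (v k *+ k) *: L ^+ k + S2 - (S1 + s *: (v k *: L ^+ k)) =
   (v k *+ k - s * v k)%:P * L ^+ k.
  rewrite mul_polyC scalerA [RHS]scalerBl.
  have E (A B : {poly F}) : S1 - S2 + A + S2 - (S1 + B) = A - B by ring.
  exact: E.
exact: dvdp_mulIr.
Qed.

Lemma pade_poly_mod k w i :
  lin i ^+ k.+1 %| pade_poly k w - (Delta F a ^+ (k.+1 + k) * w i) *: pade_part k i.
Proof.
rewrite -scalerA; have := idem_sum_mod a k (fun l => w l *: pade_part k l) i.
rewrite /pade_poly; under eq_bigr => l _ do rewrite -scalerAr.
exact.
Qed.

(** At each node [pade_poly] is a multiple of [pade_part] up to a multiple of [lin i ^+ k.+1];
    differentiating the latter costs one order, hence the exponent [k]. *)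
Lemma pade_poly_ode k w :
  D ^+ k %| shift * (pade_poly k w)^`() - pade_exp k *: pade_poly k w.
Proof.
apply: dvdp_node_poly_exp => // i; set s := pade_exp k; set P := pade_poly k w.
have := pade_part_ode k i; have := pade_poly_mod k w i.
rewrite -/s -/P; set V := pade_part k i; set c := _ * w i; set L := lin i.
move=> /dvdpP[S ES] /dvdpP[T ET].
have -> : P = c%:P * V + S * L ^+ k.+1 by rewrite -ES mul_polyC addrC subrK.
have dL : (L ^+ k.+1)^`() = L ^+ k *+ k.+1 by rewrite deriv_exp derivXsubC mul1r.
rewrite derivD !derivM derivC mul0r add0r dL -mul_polyC.
have -> : shift * (c%:P * V^`() + (S^`() * L ^+ k.+1 + S * (L ^+ k *+ k.+1))) -
    s%:P * (c%:P * V + S * L ^+ k.+1) =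
  c%:P * (shift * V^`() - s%:P * V) +
    (shift * (S^`() * L + S *+ k.+1) - s%:P * S * L) * L ^+ k.
  rewrite exprS [S * (_ *+ _)]mulrnAr -[S * L ^+ k *+ _]mulrnAl; move: (S *+ k.+1) (L ^+ k) shift => X Y Z.
  ring.
by rewrite [s%:P * V]mul_polyC ET dvdp_add ?dvdp_mull.
Qed.

Lemma size_node_poly : size D = 4.
Proof. by rewrite /node_poly size_prod_XsubC /index_enum -enumT size_enum_ord. Qed.

Lemma node_poly_monic : D \is monic.
Proof. exact: monic_prod_XsubC. Qed.

Lemma size_node_poly_exp k : size (D ^+ k) = (3 * k).+1.
Proof.
have := size_exp D k; rewrite size_node_poly /= => <-; rewrite prednK //.
by rewrite size_poly_gt0 monic_neq0 // monic_exp // node_poly_monic.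
Qed.

(* The residue at infinity of the derivative of p / D ^ k vanishes. *)
Lemma lam_exact k p : lam a k (p^`() * D - (p * D^`()) *+ k) = 0.
Proof.
(* The quotient contributes a multiple of [D ^+ k.+1], the remainder a polynomial of degree below
   [3 * k + 2]; [lam] kills both. *)
rewrite (divp_eq p (D ^+ k)); set H := _ %/ _; set R := _ %% _.
have sR : (size R <= 3 * k)%N.
  rewrite -ltnS -size_node_poly_exp ltn_modp.
  by rewrite monic_neq0 // monic_exp // node_poly_monic.
have -> : (H * D ^+ k + R)^`() * D - ((H * D ^+ k + R) * D^`()) *+ k =
    D ^+ k.+1 * H^`() + (R^`() * D - (R * D^`()) *+ k).
  rewrite derivD derivM deriv_exp !mulrDl mulrnDl opprD addrACA; congr (_ + _).
  rewrite -[in RHS]mulrC -!mulrnAl.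
  clear sR; move: H R; case: k => [|k] H R /=; first by rewrite !mulr0n; ring.
  by rewrite -(mulr_natl H) -(mulr_natl D^`()) !exprS; ring.
rewrite linearD /= lam_node_poly add0r.
have [->|R0] := eqVneq R 0; first by rewrite deriv0 !mul0r mul0rn subr0 linear0.
apply: lam_low.
apply: (leq_ltn_trans (size_polyD _ _)); rewrite gtn_max size_polyN.
have sdD : (size D^`() <= 3)%N by have := lt_size_deriv (monic_neq0 node_poly_monic); rewrite size_node_poly.
have sdR := lt_size_deriv R0.
have s1 := size_polyMleq R^`() D; have s2 := size_polyMleq R D^`().
have s3 : (size ((R * D^`()) *+ k)%R <= size (R * D^`())%R)%N.
  by rewrite -scaler_nat size_scale_leq.
rewrite size_node_poly in s1.
have arith (x1 x2 x3 x4 x5 x6 : nat) : (x1 < x4 -> x2 <= (x1 + 4).-1 ->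
   x3 <= 3 -> x4 <= 3 * k -> x5 <= (x4 + x3).-1 -> x6 <= x5 ->
   (x2 < 3 * k.+1) && (x6 < 3 * k.+1))%N by lia.
exact: arith sdR s1 sdD sR s2 s3.
Qed.

(* The numerator of the derivative of shift ^ (s + 1) q / D ^ k, divided by
   shift ^ s, where s = pade_exp k. *)
Definition exact_numer k q : {poly F} :=
  (pade_exp k + 1) *: (q * D) + shift * (q^`() * D - (q * D^`()) *+ k).

(** This is [lam_exact] for [shift * q * pade_poly k w]: modulo [D ^+ k.+1], the differential
    equation turns the derivative of [pade_poly] back into [pade_poly]. *)
Lemma lam_exact_numer k w q : lam a k (exact_numer k q * pade_poly k w) = 0.
Proof.
have /dvdpP[R ER] := pade_poly_ode k w; set P := pade_poly k w in ER *.
have := lam_exact k (shift * q * P); set s := pade_exp k in ER.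
have -> : (shift * q * P)^`() * D - (shift * q * P * D^`()) *+ k =
    exact_numer k q * P + D ^+ k.+1 * (q * R).
  rewrite !derivM derivD derivX derivC addr0 mul1r /exact_numer -/s.
  have E0 : shift * P^`() - s%:P * P - R * D ^+ k = 0 by rewrite mul_polyC ER subrr.
  apply: subr0_eq; transitivity ((shift * P^`() - s%:P * P - R * D ^+ k) * (q * D)).
    rewrite exprSr -(mul_polyC (s + 1)) polyCD -2!(mulr_natl _ k).
    ring.
  by rewrite E0 mul0r.
rewrite linearD /= lam_node_poly addr0; exact.
Qed.


Lemma coef_exact_numer k m h : (0 < h)%N ->
  (exact_numer k 'X^m)`_(m + h) =
  (pade_exp k + 1 + m%:R - k%:R * h%:R) * D`_h
  + N%:R * (m%:R - k%:R * h.+1%:R) * D`_h.+1.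
Proof.
move=> h0; pose A := ('X^m)^`() * D - ('X^m * D^`()) *+ k.
have cA g : A`_(m + g) = (m%:R - k%:R * g.+1%:R) * D`_g.+1.
  rewrite /A coefB coefMn coefXnM ltnNge leq_addr /= addKn coef_deriv derivXn.
  rewrite mulrnAl coefMn mulrBl -[_ *+ g.+1]mulr_natl -[_ *+ k]mulr_natl mulrA.
  congr (_ - _); case: (m) => [|m']; first by rewrite mul0r mulr0n.
  by rewrite coefXnM /= addSnnS ltnNge leq_addr /= addKn mulr_natl.
rewrite /exact_numer -/A coefD coefZ [_ * A]mulrDl coefD coefXM coefCM cA.
rewrite coefXnM ltnNge leq_addr /= addKn; case: h h0 => [|h] // _.
by rewrite addnS /= cA; ring.
Qed.

Lemma node_poly_coef3 : D`_3 = 1.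
Proof. by have := node_poly_monic; rewrite monicE lead_coefE size_node_poly => /eqP. Qed.

(** Induction on the size: subtracting a multiple of [exact_numer k 'X^m], of degree [m + 3], lowers
    the degree of [p] and leaves the value of [lam] unchanged. *)
Lemma pade_poly_reduce k w :
  (forall n, (n < 3)%N -> lam a k ('X^n * pade_poly k w) = 0) ->
  forall p, lam a k (p * pade_poly k w) = 0.
Proof.
set P := pade_poly k w => lowP p; have [n] := ubnP (size p).
elim: n p => [|n IHn] p //; rewrite ltnS => pn.
have [p3|] := leqP (size p) 3.
  rewrite -(coefK p) poly_def mulr_suml linear_sum big1 // => h _.
  by rewrite -scalerAl linearZ /= lowP ?mulr0 // (leq_trans _ p3).
case sp: (size p) => [|[|[|[|m]]]] // _.
pose e := pade_exp k + 1 + m%:R - k%:R * 3.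
(* Twice [e] is the odd integer [2 * m + 3 - 4 * k]; here the half-integrality of the exponent is
   decisive. *)
have e0 : e != 0.
  apply/eqP => e0; have : (2 * m + 3)%:R == (4 * k)%:R :> F.
    rewrite natrD !natrM; apply/eqP; move: e0; rewrite /e /pade_exp.
    rewrite -[k.+1%:R]natr1 => e0; lra.
  by rewrite eqr_nat; lia.
have ce : (exact_numer k 'X^m)`_(m + 3) = e.
  rewrite coef_exact_numer // node_poly_coef3 [D`_4]nth_default ?size_node_poly //.
  by rewrite mulr0 addr0 mulr1.
pose c := p`_(m + 3) / e.
have -> : p = (p - c *: exact_numer k 'X^m) + c *: exact_numer k 'X^m by rewrite subrK.
rewrite mulrDl linearD -scalerAl [X in _ + X]linearZ /= lam_exact_numer mulr0 addr0.
apply: IHn; apply: (@leq_trans m.+4); last by rewrite -sp.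
rewrite ltnS; apply/leq_sizeP => j mj; rewrite coefB coefZ.
have [->|jm] := eqVneq j m.+3.
  by rewrite -addn3 ce /c divfK // subrr.
have -> : j = (m + (j - m))%N by lia.
rewrite coef_exact_numer; last by lia.
have s4 x : (3 < x)%N -> D`_x = 0 by move=> x3; rewrite nth_default // size_node_poly.
rewrite !s4 ?mulr0 ?addr0 ?mulr0 ?subr0; try lia.
by rewrite nth_default // sp; lia.
Qed.

Lemma lam_top k p : (size p <= 3 * k.+1)%N -> lam a k p = p`_(3 * k).+2.
Proof.
have E : (3 * k.+1 = (3 * k).+3)%N by lia.
rewrite E => pE; rewrite /lam (moment_wide _ pE) big_ord_recr big1 /= => [|h _].
  by rewrite (@divdiff_lead _ _ (3 * k).+2) ?mulr1 ?add0r // size_nodes E.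
by rewrite divdiff_small ?mulr0 // size_nodes E ltnS; exact: ltn_ord h.
Qed.

Lemma lam_nondegenerate k q : (forall p, lam a k (p * q) = 0) -> D ^+ k.+1 %| q.
Proof.
move=> lq; apply: contraT; rewrite /dvdp; set R := _ %% _ => R0.
have D0 : D ^+ k.+1 != 0 by rewrite monic_neq0 // monic_exp // node_poly_monic.
have sR : (size R <= 3 * k.+1)%N by rewrite -ltnS -size_node_poly_exp ltn_modp.
(* This shift moves the leading coefficient of [R] to degree [3 * k + 2], the one that [lam] reads
   off. *)
pose e := (3 * k.+1 - size R)%N; have := lq 'X^e.
rewrite (divp_eq q (D ^+ k.+1)) -/R mulrDr linearD /= mulrA lam_dvdp ?dvdp_mulIr //.
rewrite add0r lam_top; last first.
  by apply: leq_trans (size_polyMleq _ _) _; rewrite size_polyXn /= subnK.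
have R1 : (0 < size R)%N by rewrite size_poly_gt0.
rewrite coefXnM; have -> : ((3 * k).+2 < e)%N = false by rewrite /e; lia.
have -> : ((3 * k).+2 - e = (size R).-1)%N by rewrite /e; lia.
by move/eqP; rewrite -lead_coefE lead_coef_eq0 (negPf R0).
Qed.

Hypothesis N_gt0 : (0 < N)%N.

(** Otherwise [lam] kills all multiples of [pade_poly], which then vanishes at node [i]; but its
    value there is [w i * (N + a i)^k] times a power of [Delta]. *)
Theorem pade_poly_nonvanishing k w i : w i != 0 ->
  exists2 n, (n < 3)%N & lam a k ('X^n * pade_poly k w) != 0.
Proof.
move=> wi; pose b (n : 'I_3) := lam a k ('X^n * pade_poly k w) == 0.
case: (boolP [forall n, b n]) => [/forallP bn|/forallPn[n nb]]; last by exists n.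
have low n : (n < 3)%N -> lam a k ('X^n * pade_poly k w) = 0.
  by move=> n3; have /eqP := bn (Ordinal n3).
have := dvdp_trans (node_poly_exp_dvdp F a k.+1 i)
  (lam_nondegenerate (pade_poly_reduce low)).
move=> dP; have := pade_poly_mod k w i; rewrite dvdp_subr //.
set c := _ * w i => dV.
have /dvdp_trans/(_ dV) : lin i %| lin i ^+ k.+1 by rewrite exprS dvdp_mulIl.
rewrite dvdp_XsubCl rootE hornerZ /pade_part /taylor_sum horner_sum big_ord_recl big1.
  rewrite expr0 hornerZ hornerC mulr1 addr0 /pade_coef half_bin0 mul1r subn0.
  rewrite !mulf_eq0 !expf_eq0 (negPf wi) (negPf (Delta_neq0 F a_inj)).
  have t0 : (N + a i)%:R != 0 :> F by rewrite pnatr_eq0 -lt0n addn_gt0 N_gt0.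
  by rewrite (negPf t0) !andbF.
by move=> j _; rewrite lift0 !hornerE subrr expr0n mulr0.
Qed.

End PadeForms.

(** * Size of the approximating forms *)

Section PadeBounds.
Variables (F : archiRcfType) (a : 'I_3 -> nat) (N : nat).
Hypothesis a_inj : injective a.
Hypothesis N_large : (2 * max_node a <= N)%N.
Implicit Types (p q : {poly F}) (i l : 'I_3) (k n j : nat) (w : 'I_3 -> F).

Local Notation lin i := ('X - ((a i)%:R : F)%:P).
Local Notation C0 := (lam_const F a).

(** The factor [4 ^+ k] clears the denominators of the half-integral binomial coefficients of index
    at most [k]. *)
Definition pade_form k n i : F :=
  4 ^+ k * lam a k ('X^n * (idem F a k i * pade_part F a N k i)).

Lemma sum_pade_form k n w :
  \sum_i w i * pade_form k n i = 4 ^+ k * lam a k ('X^n * pade_poly a N k w).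
Proof.
rewrite /pade_poly ['X^n * _]mulr_sumr linear_sum mulr_sumr; apply: eq_bigr => i _.
by rewrite -scalerAr linearZ /= mulrCA.
Qed.

Lemma taylor_sumZ k i (c : F) v :
  c *: taylor_sum a k i v = taylor_sum a k i (fun j => c * v j).
Proof. by rewrite scaler_sumr; apply: eq_bigr => j _; rewrite scalerA. Qed.

Lemma pade_form_int k n i : pade_form k n i \is a Num.int.
Proof.
have -> : pade_form k n i =
    lam a k ('X^n * (idem F a k i * (4 ^+ k *: pade_part F a N k i))).
  by rewrite -!scalerAr linearZ.
apply: lam_int; rewrite rpredM ?rpredX ?polyOverX //.
rewrite rpredM ?idem_int // /pade_part taylor_sumZ.
apply: taylor_sum_int => j jk; rewrite /pade_coef mulrA rpredM ?rpredX ?rpred_nat //.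
by rewrite -(subnK jk) exprD -mulrA rpredM ?half_bin_int // rpredX // rpred_nat.
Qed.

Lemma node_le i : (a i <= max_node a)%N.
Proof. by rewrite ltnW // ltnS; exact: leq_bigmax. Qed.

Lemma max_node_gt0 : (0 < max_node a)%N.
Proof. by []. Qed.

Lemma N_gt0 : (0 < N)%N.
Proof. by have := max_node_gt0; lia. Qed.

Lemma pade_coef_bound k i j : (j <= k)%N ->
  `|pade_coef F a N k i j| <= 2 ^+ k.+1 * (2 * N%:R) ^+ k.
Proof.
move=> jk; rewrite /pade_coef normrM; apply: ler_pM => //; first exact: half_bin_bound.
have N0 := N_gt0; have aN := node_le i.
rewrite normrX normr_nat -natrM -!natrX ler_nat.
apply: (@leq_trans ((2 * N) ^ (k - j))).
  by case: (k - j)%N => [|e] //; rewrite leq_exp2r //; lia.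
by rewrite leq_pexp2l // ?leq_subr //; lia.
Qed.

Lemma lam_const_ge0 : 0 <= C0.
Proof. by apply: le_trans (lam_const_ge1 F a). Qed.

Lemma pade_form_bound k n i : (n < 3)%N ->
  `|pade_form k n i| <= (16 * C0) ^+ k.+1 * N%:R ^+ k.
Proof.
move=> n3; rewrite /pade_form normrM ger0_norm ?exprn_ge0 //.
have M0 : 0 <= 2 ^+ k.+1 * (2 * N%:R) ^+ k :> F by rewrite mulr_ge0 ?exprn_ge0 ?mulr_ge0.
have H := @lam_const_bound F a k i n _ _ n3 M0 (@pade_coef_bound k i).
apply: le_trans (ler_wpM2l _ H) _; first by rewrite exprn_ge0.
have -> : 4 ^+ k * (C0 ^+ k.+1 * (2 ^+ k.+1 * (2 * N%:R) ^+ k)) =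
    C0 ^+ k.+1 * N%:R ^+ k * (4 ^+ k * (2 ^+ k.+1 * 2 ^+ k)).
  by rewrite [(2 * N%:R) ^+ k]exprMn; ring.
have -> : (16 * C0) ^+ k.+1 * N%:R ^+ k = C0 ^+ k.+1 * N%:R ^+ k * 16 ^+ k.+1.
  by rewrite [(16 * C0) ^+ _]exprMn; ring.
apply: ler_wpM2l; first by rewrite mulr_ge0 ?exprn_ge0 ?lam_const_ge0.
rewrite -!natrX -!natrM ler_nat.
(* The factors come from clearing denominators, from [half_bin_bound], and from
   [N + a i <= 2 * N]. *)
have -> : 16%N = (4 * 2 * 2)%N by [].
by rewrite !expnMn mulnA !leq_mul ?leq_exp2l.
Qed.

(** The [j]-th Taylor coefficient at [a i] of [(N + z)^(k + 1/2)] minus its expansion in [z / N] cut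
    at order [3 * k]. The quotient of powers of [N] allows for [h > k]. *)
Definition pade_diff k i j : F :=
  Num.sqrt (N + a i)%:R * pade_coef F a N k i j -
  \sum_(h < 3 * k) Num.sqrt N%:R * half_bin F k.+1 h * (N%:R ^+ k / N%:R ^+ h) *
    ((a i)%:R ^+ (h - j) *+ 'C(h, j)).

(** Terms with [h < j] vanish with their binomial coefficient; trinomial revision turns the rest
    into the series of [(1 + u)^(k - j + 1/2)] at [u = a i / N], of length [3 * k - j]. *)
Lemma pade_diffE k i j : (0 < k)%N -> (j <= k)%N -> pade_diff k i j =
  Num.sqrt N%:R * N%:R ^+ (k - j) * half_bin F k.+1 j *
  ((1 + (a i)%:R / N%:R) ^+ (k.+1 - j) / Num.sqrt (1 + (a i)%:R / N%:R) -
   trunc_binom (3 * k - j) (k.+1 - j) ((a i)%:R / N%:R)).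
Proof.
move=> k0 jk; set u := _%:R / _%:R; set s := Num.sqrt N%:R.
have N0 : N%:R != 0 :> F by rewrite pnatr_eq0 -lt0n N_gt0.
have u0 : 0 <= u by rewrite divr_ge0 ?ler0n.
have u1 : 0 < 1 + u by apply: (@lt_le_trans _ _ 1) => //; rewrite lerDl.
have ENa : (N + a i)%:R = N%:R * (1 + u) by rewrite natrD /u; field.
rewrite /pade_diff mulrBr; congr (_ - _).
  rewrite ENa sqrtrM // -/s /pade_coef ENa exprMn subSn // exprS.
  have : Num.sqrt (1 + u) ^+ 2 = 1 + u by rewrite sqr_sqrtr // ltW.
  have : Num.sqrt (1 + u) != 0 by rewrite gt_eqF // sqrtr_gt0.
  set y := Num.sqrt (1 + u) => y0 yy.
  have -> : (1 + u) * (1 + u) ^+ (k - j) / y = y * (1 + u) ^+ (k - j).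
    by rewrite -{1}yy; field.
  ring.
have E : (3 * k = j + (3 * k - j))%N by lia.
pose f h := s * half_bin F k.+1 h * (N%:R ^+ k / N%:R ^+ h) *
  ((a i)%:R ^+ (h - j) *+ 'C(h, j)) : F.
have -> : \sum_(h < 3 * k) f h = \sum_(h < 3 * k - j) f (j + h)%N.
  transitivity (\sum_(h < j + (3 * k - j)) f h); first by rewrite -E.
  rewrite big_split_ord /= big1 ?add0r // => h _.
  by rewrite /f bin_small // mulr0n mulr0.
rewrite /trunc_binom mulr_sumr; apply: eq_bigr => h _; rewrite /f addKn.
have H := half_bin_mul_bin F h (leqW jk).
transitivity (s * (N%:R ^+ k / N%:R ^+ (j + h)) * (a i)%:R ^+ h *
   (half_bin F k.+1 (j + h) * 'C(j + h, j)%:R)); first ring.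
rewrite H /u expr_div_n exprD -{1}(subnK jk) exprD.
have Nj : N%:R ^+ j != 0 :> F by rewrite expf_neq0.
have Nh : N%:R ^+ h != 0 :> F by rewrite expf_neq0.
by field; rewrite Nj Nh.
Qed.

Definition diff_const k : F :=
  2 ^+ k.+1 * 4 ^+ k.+2 * (max_node a)%:R ^+ (3 * k).

(** The series error of order [u ^+ (3 * k - j)] meets the prefactor [N ^+ (k - j)], which leaves
    [N^(-2k)] whatever [j] is. *)
Lemma pade_diff_bound k i j : (0 < k)%N -> (j <= k)%N ->
  `|pade_diff k i j| <= diff_const k * Num.sqrt N%:R / N%:R ^+ (2 * k).
Proof.
move=> k0 jk; rewrite pade_diffE //; set u := _%:R / _%:R; set s := Num.sqrt N%:R.
have N0 : 0 < N%:R :> F by rewrite ltr0n N_gt0.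
have s0 : 0 <= s by apply: sqrtr_ge0.
have m1 : 1 <= (max_node a)%:R :> F by rewrite ler1n.
have u0 : 0 <= u by rewrite divr_ge0 ?ler0n.
have u2 : u <= 2^-1.
  rewrite /u ler_pdivrMr // mulrC ler_pdivlMr // -natrM ler_nat.
  by have := node_le i; lia.
have Em : (3 * k - j = (3 * k - j).-1.+1)%N by lia.
have H := trunc_binom_error (3 * k - j).-1 (k.+1 - j) u0 u2.
rewrite -Em in H; rewrite normrM.
apply: (@le_trans _ _ ((s * N%:R ^+ (k - j) * 2 ^+ k.+1) *
    (4 ^+ k.+2 * u ^+ (3 * k - j)))).
  apply: ler_pM => //.
    have sN : 0 <= s * N%:R ^+ (k - j) by rewrite mulr_ge0 // exprn_ge0 // ltW.
    rewrite normrM (ger0_norm sN); apply: ler_wpM2l => //.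
    exact: half_bin_bound.
  apply: le_trans H _; apply: ler_wpM2r; first exact: exprn_ge0.
  by apply: ler_weXn2l; [rewrite ler1n | lia].
have -> : s * N%:R ^+ (k - j) * 2 ^+ k.+1 * (4 ^+ k.+2 * u ^+ (3 * k - j)) =
    2 ^+ k.+1 * 4 ^+ k.+2 * s / N%:R ^+ (2 * k) * (a i)%:R ^+ (3 * k - j).
  have E : (3 * k - j = 2 * k + (k - j))%N by lia.
  rewrite /u expr_div_n [in X in _ / X]E exprD.
  have n1 : N%:R ^+ (2 * k) != 0 :> F by rewrite expf_neq0 // gt_eqF.
  have n2 : N%:R ^+ (k - j) != 0 :> F by rewrite expf_neq0 // gt_eqF.
  by field; rewrite n1 n2.
have -> : diff_const k * s / N%:R ^+ (2 * k) =
  2 ^+ k.+1 * 4 ^+ k.+2 * s / N%:R ^+ (2 * k) * (max_node a)%:R ^+ (3 * k).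
  by rewrite /diff_const; ring.
apply: ler_wpM2l.
  apply: divr_ge0; last by rewrite exprn_ge0 // ltW.
  by apply: mulr_ge0 => //; apply: mulr_ge0; apply: exprn_ge0; apply: ler0n.
apply: (@le_trans _ _ ((max_node a)%:R ^+ (3 * k - j))).
  by rewrite lerXn2r ?nnegrE // ler_nat node_le.
by apply: ler_weXn2l => //; lia.
Qed.

(* A truncation at order 3 k of the expansion of (N + X) ^ (k + 1/2) in powers of
   X / N; its degree is too small for lam to see it. *)
Definition truncation k : {poly F} :=
  \sum_(h < 3 * k) (Num.sqrt N%:R * half_bin F k.+1 h * (N%:R ^+ k / N%:R ^+ h)) *: 'X^h.

Lemma lam_truncation k n : (n < 3)%N -> lam a k ('X^n * truncation k) = 0.
Proof.
move=> n3; apply: lam_low; apply: (leq_ltn_trans (size_polyMleq _ _)).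
have st : (size (truncation k) <= 3 * k)%N.
  apply: (leq_trans (size_sum _ _ _)); apply/bigmax_leqP => h _.
  by apply: leq_trans (size_scale_leq _ _) _; rewrite size_polyXn.
by rewrite size_polyXn; lia.
Qed.

(** Expand ['X] as [x + L]: by the choice of [pade_diff] the coefficients up to degree [k] cancel,
    and the others carry the factor [L ^+ k.+1]. *)
Lemma truncation_taylor k i : (0 < k)%N -> lin i ^+ k.+1 %| truncation k -
  (Num.sqrt (N + a i)%:R *: pade_part F a N k i - taylor_sum a k i (pade_diff k i)).
Proof.
move=> k0; pose L := lin i; pose x : F := (a i)%:R.
pose G h : F := Num.sqrt N%:R * half_bin F k.+1 h * (N%:R ^+ k / N%:R ^+ h).
pose g j : F := \sum_(h < 3 * k) G h * (x ^+ (h - j) *+ 'C(h, j)).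
have -> : truncation k = \sum_(j < 3 * k) g j *: L ^+ j.
  rewrite /truncation; under [RHS]eq_bigr => j _ do rewrite scaler_suml.
  rewrite exchange_big; apply: eq_bigr => h _ /=.
  under [RHS]eq_bigr => j _ do rewrite -scalerA.
  rewrite -scaler_sumr; congr (_ *: _).
  have -> : 'X = x%:P + L :> {poly F} by rewrite addrC subrK.
  rewrite exprDn (big_ord_widen (3 * k) (fun j => (x%:P ^+ (h - j) * L ^+ j) *+ 'C(h, j))) //.
  rewrite big_mkcond; apply: eq_bigr => j _; case: ltnP => hj.
    by rewrite -polyC_exp mul_polyC scalerMnl.
  by rewrite bin_small // mulr0n scale0r.
have -> : Num.sqrt (N + a i)%:R *: pade_part F a N k i - taylor_sum a k i (pade_diff k i) =
    \sum_(j < k.+1) g j *: L ^+ j.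
  rewrite /pade_part taylor_sumZ -sumrB; apply: eq_bigr => j _.
  by rewrite -scalerBl /pade_diff opprB addrC subrK.
have E : (3 * k = k.+1 + (2 * k).-1)%N by lia.
have -> : \sum_(j < 3 * k) g j *: L ^+ j =
    \sum_(j < k.+1 + (2 * k).-1) g j *: L ^+ j by rewrite -E.
rewrite big_split_ord /= addrAC subrr add0r.
apply: (big_ind (fun p => L ^+ k.+1 %| p)); first exact: dvdp0.
  by move=> p q; exact: dvdp_add.
by move=> j _; rewrite exprD -mul_polyC dvdp_mull // dvdp_mulIl.
Qed.

(** For weights [sqrt (N + a i)], [pade_poly] is, modulo [D ^+ k.+1], a constant times [truncation]
    plus a combination of the Taylor sums of [pade_diff]; [lam] sees only the latter, which are
    small. *)
Lemma pade_form_small k n : (0 < k)%N -> (n < 3)%N ->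
  `|\sum_i Num.sqrt (N + a i)%:R * pade_form k n i| <=
  4 ^+ k * (3 * (C0 ^+ k.+1 * (diff_const k * Num.sqrt N%:R / N%:R ^+ (2 * k)))).
Proof.
move=> k0 n3; rewrite sum_pade_form normrM ger0_norm ?exprn_ge0 //.
apply: ler_wpM2l; first exact: exprn_ge0.
set w := fun i => Num.sqrt (N + a i)%:R.
pose T i := taylor_sum a k i (pade_diff k i).
have -> : lam a k ('X^n * pade_poly a N k w) =
    \sum_i lam a k ('X^n * (idem F a k i * T i)).
  pose c : F := Delta F a ^+ (k.+1 + k).
  have H : node_poly F a ^+ k.+1 %|
      pade_poly a N k w - \sum_i idem F a k i * T i - c *: truncation k.
    apply: dvdp_node_poly_exp => // i.
    pose q l := w l *: pade_part F a N k l - T l.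
    have -> : pade_poly a N k w - \sum_i idem F a k i * T i - c *: truncation k =
      (\sum_l idem F a k l * q l - c *: q i) - c%:P * (truncation k - q i).
      have -> : \sum_l idem F a k l * q l = pade_poly a N k w - \sum_i idem F a k i * T i.
        rewrite /pade_poly -sumrB; apply: eq_bigr => l _.
        by rewrite mulrBr scalerAr.
      by rewrite -!(mul_polyC c); ring.
    by apply: dvdp_sub; [exact: idem_sum_mod | rewrite dvdp_mull // truncation_taylor].
  rewrite -[pade_poly a N k w](subrK (\sum_i idem F a k i * T i)).
  rewrite -[pade_poly _ _ _ _ - _](subrK (c *: truncation k)).
  move: H; set X := _ - c *: _ => H; set S := \sum_i _.
  rewrite mulrDr linearD mulrDr linearD /= (lam_dvdp (dvdp_mull _ H)) add0r.
  by rewrite -scalerAr linearZ /= lam_truncation // mulr0 add0r ['X^n * _]mulr_sumr linear_sum.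
apply: le_trans (ler_norm_sum _ _ _) _.
have -> : 3 = \sum_(i < 3) 1 :> F by rewrite sumr_const card_ord.
rewrite mulr_suml; apply: ler_sum => i _; rewrite mul1r.
apply: lam_const_bound => // [|j jk]; last exact: pade_diff_bound.
apply: divr_ge0; last exact: exprn_ge0.
apply: mulr_ge0; last exact: sqrtr_ge0.
by apply: mulr_ge0; [apply: mulr_ge0 |]; exact: exprn_ge0.
Qed.

End PadeBounds.

Theorem pade_forms (F : archiRcfType) (a : 'I_3 -> nat) : injective a ->
  exists C : nat, forall N k (w : 'I_3 -> F) i0, (C <= N)%N -> (0 < k)%N -> w i0 != 0 ->
  exists r : 'I_3 -> F, [/\ forall i, r i \is a Num.int,
    forall i, `|r i| <= C%:R ^+ k.+1 * N%:R ^+ k,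
    `|\sum_i Num.sqrt (N + a i)%:R * r i| <= Num.sqrt N%:R * C%:R ^+ k.+1 / N%:R ^+ (2 * k) &
    \sum_i w i * r i != 0].
Proof.
(* Here 384 is [4 * 3 * 2 * 4 ^ 2], collecting the constants of [pade_form_small] and [diff_const];
   it also exceeds the 16 of [pade_form_bound]. *)
move=> a_inj; pose C1 : F := 384 * lam_const F a * (max_node a)%:R ^+ 3.
have L1 := lam_const_ge1 F a; have L0 : 0 <= lam_const F a by apply: le_trans L1.
have m1 : 1 <= (max_node a)%:R :> F by rewrite ler1n.
have C10 : 0 <= C1 by apply: mulr_ge0; [apply: mulr_ge0 | apply: exprn_ge0].
exists (maxn (2 * max_node a) (Num.bound C1)) => N k w i0.
set C := maxn _ _; rewrite geq_max => /andP[N_large _] k0 wi.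
have C1C : C1 <= C%:R.
  apply: le_trans (ltW (archi_boundP C10)) _.
  by rewrite ler_nat leq_maxr.
have [n n3 nz] := pade_poly_nonvanishing a_inj (N_gt0 N_large) k wi.
exists (pade_form F a N k n); split.
- by move=> i; exact: pade_form_int.
- move=> i; apply: le_trans (pade_form_bound F N_large k i n3) _.
  apply: ler_wpM2r; first by rewrite exprn_ge0.
  have l16 : 16 * lam_const F a <= C%:R.
    apply: le_trans C1C; have : 1 <= (max_node a)%:R ^+ 3 :> F by exact: exprn_ege1.
    rewrite /C1; set m := _ ^+ 3; nra.
  by apply: lerXn2r => //; rewrite nnegrE // mulr_ge0.
- apply: le_trans (pade_form_small F a_inj N_large k0 n3) _.
  rewrite /diff_const; set s := Num.sqrt _; set Q := _ ^+ (2 * k).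
  set l := lam_const F a; set m : F := (max_node a)%:R.
  have -> : 4 ^+ k * (3 * (l ^+ k.+1 * (2 ^+ k.+1 * 4 ^+ k.+2 * m ^+ (3 * k) * s / Q))) =
     s * (4 ^+ k * 3 * 2 ^+ k.+1 * 4 ^+ k.+2 * l ^+ k.+1 * m ^+ (3 * k)) / Q by ring.
  apply: ler_wpM2r; first by rewrite invr_ge0 exprn_ge0.
  apply: ler_wpM2l; first exact: sqrtr_ge0.
  apply: (@le_trans _ _ (C1 ^+ k.+1)); last by apply: lerXn2r => //; rewrite nnegrE.
  have -> : C1 ^+ k.+1 = 384 ^+ k.+1 * l ^+ k.+1 * m ^+ (3 * k.+1).
    by rewrite [C1 ^+ _]exprMn [(384 * _) ^+ _]exprMn -exprM.
  have lk : 0 <= l ^+ k.+1 by exact: exprn_ge0.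
  have le384 : (4 ^ k * 3 * 2 ^ k.+1 * 4 ^ k.+2 <= 384 ^ k.+1)%N.
    have -> : 384%N = (4 * 3 * 2 * (4 * 4))%N by [].
    rewrite !expnMn -[in X in (_ <= X)%N]expnD; apply: leq_mul; last by rewrite leq_exp2l //; lia.
    apply: leq_mul => //; apply: leq_mul; first by rewrite leq_exp2l.
    by rewrite expnS leq_pmulr // expn_gt0.
  have -> : 4 ^+ k * 3 * 2 ^+ k.+1 * 4 ^+ k.+2 = (4 ^ k * 3 * 2 ^ k.+1 * 4 ^ k.+2)%:R :> F.
    by rewrite 3!natrM !natrX.
  rewrite -(natrX _ 384); apply: ler_pM.
  - by apply: mulr_ge0; rewrite ?ler0n.
  - by apply: exprn_ge0; apply: le_trans m1.
  - by apply: ler_wpM2r; rewrite ?ler_nat.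
  - by apply: ler_weXn2l => //; lia.
- rewrite sum_pade_form mulf_neq0 // expf_neq0 // pnatr_eq0 //.
Qed.

(** * Simultaneous Pell equations *)

(** Scanning from 3, [k] is the index just before the bound [f k < X] first fails, and [X <= f k.+1]
    yields the other inequality. Since [k >= 3], [2 * k + 4 <= 6 * (2 * k - 4)], so the powers of
    [4 * P] are absorbed by [x ^ (2 * k - 4)]. *)
Lemma approximation_window (P x X : nat) : (0 < P)%N -> ((4 * P) ^ 6 <= x)%N ->
  (2 * (P ^ 5 * x ^ 7) < X)%N ->
  exists k, [/\ (0 < k)%N, (2 * (P ^ k.+2 * x ^ (2 * k).+1) < X)%N &
    (2 * (X * x * P ^ k.+1) <= x ^ (4 * k))%N].
Proof.
move=> P0 xP X7; pose f k := (2 * (P ^ k.+2 * x ^ (2 * k).+1))%N.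
have x2 : (1 < x)%N.
  by apply: leq_trans xP; apply: (@leq_trans (4 ^ 6)) => //; rewrite leq_exp2r //; lia.
have exX : exists j, (X <= f (3 + j))%N.
  exists X; apply: leq_trans (_ : X <= x ^ (2 * (3 + X)).+1)%N _.
    by apply: leq_trans (ltnW (ltn_expl _ x2)); lia.
  by rewrite /f mulnA leq_pmull // muln_gt0 expn_gt0 P0.
have [j jX jmin] := ex_minnP exX.
case: j => [|j] in jX jmin *; first by move: jX; rewrite /f leqNgt X7.
exists (3 + j)%N; split => //.
  by rewrite ltnNge; apply/negP => /jmin; rewrite ltnn.
set k := (3 + j)%N; have k3 : (3 <= k)%N by rewrite leq_addr.
have {jX} jX : (X <= 2 * (P ^ k.+3 * x ^ (2 * k).+3))%N.
  by move: jX; rewrite /f addnS -/k mulnS.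
apply: (@leq_trans (2 * (2 * (P ^ k.+3 * x ^ (2 * k).+3) * x * P ^ k.+1))%N).
  by rewrite leq_mul2l /= !leq_mul.
have -> : (2 * (2 * (P ^ k.+3 * x ^ (2 * k).+3) * x * P ^ k.+1) =
    4 * P ^ (2 * k + 4) * x ^ (2 * k + 4))%N.
  have -> : (2 * k + 4 = k.+3 + k.+1)%N by lia.
  have -> : (x ^ (k.+3 + k.+1) = x ^ (2 * k).+3 * x)%N.
    by rewrite -expnSr; congr (_ ^ _)%N; lia.
  by rewrite expnD; move: (P ^ _)%N (P ^ _)%N (x ^ _)%N => p q z; lia.
have -> : (4 * k = (2 * k - 4) + (2 * k + 4))%N by lia.
rewrite [X in (_ <= X)%N]expnD leq_mul //.
apply: (@leq_trans ((4 * P) ^ (2 * k + 4))).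
  by rewrite expnMn leq_mul // -[X in (X <= _)%N]expn1 leq_exp2l //; lia.
apply: (@leq_trans ((4 * P) ^ (6 * (2 * k - 4)))).
  by rewrite leq_exp2l //; lia.
by rewrite expnM leq_exp2r //; lia.
Qed.

(* The field F is absent from the conclusion: it only has to contain the square
   roots that occur in the proof. *)
Theorem simultaneous_pell_bounded (F : archiRcfType) (a b : 'I_3 -> nat) : injective a ->
  exists B, forall X (Y : 'I_3 -> nat),
    (forall i, X ^ 2 + a i = b i * Y i ^ 2)%N -> (X <= B)%N.
Proof.
move=> a_inj; have [C padeC] := @pade_forms F a a_inj.
(* The 6 absorbs the factor [2 * a i] in each of the three summands of [part2]. *)
pose P := (C + 6 * max_node a)%N.
have P0 : (0 < P)%N by rewrite addn_gt0 orbT.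
pose T := ((4 * P) ^ 6)%N.
(* Either no solution reaches [T], and [T] is a bound, or one such solution [x] is fixed and bounds
   all others; the resulting bound is therefore ineffective. *)
case: (pselect (exists x (y : 'I_3 -> nat), (T <= x)%N /\
    forall i, x ^ 2 + a i = b i * y i ^ 2)%N); last first.
  move=> noS; exists T => X Y XY; rewrite leqNgt; apply/negP => TX.
  by apply: noS; exists X, Y; split => //; exact: ltnW.
case=> x [y [Tx xy]]; exists (2 * (P ^ 5 * x ^ 7))%N => X Y XY.
rewrite leqNgt; apply/negP => BX.
have [k [k0 kX Xk]] := approximation_window P0 Tx BX.
pose N := (x ^ 2)%N.
have PT : (P <= T)%N.
  apply: (@leq_trans (4 * P)); first by rewrite leq_pmull.
  by rewrite -[X in (X <= _)%N]expn1 leq_exp2l //; lia.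
have x0 : (0 < x)%N by apply: leq_trans Tx; apply: leq_trans PT.
have xN : (x <= N)%N by rewrite /N -[X in (X <= _)%N]expn1 leq_pexp2l.
have X0 : (0 < X)%N by apply: leq_ltn_trans BX.
have PN : (P <= N)%N by apply: leq_trans PT (leq_trans Tx xN).
pose s i : F := Num.sqrt (N + a i)%:R; pose S i : F := Num.sqrt (X ^ 2 + a i)%:R.
have SsE i : S i * s i = (b i * (Y i * y i))%:R.
  rewrite -sqrtrM ?ler0n // /N XY xy -natrM.
  have -> : (b i * Y i ^ 2 * (b i * y i ^ 2) = (b i * (Y i * y i)) ^ 2)%N by lia.
  by rewrite natrX sqrtr_sqr ger0_norm ?ler0n.
have Ss0 : S ord0 * s ord0 != 0.
  by rewrite mulf_neq0 // gt_eqF // sqrtr_gt0 ltr0n addn_gt0 ?expn_gt0 ?X0 ?x0.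
have CN : (C <= N)%N by apply: leq_trans PN; rewrite leq_addr.
have [r [rint rb rsmall rnz]] := padeC N k (fun i => S i * s i) ord0 CN k0 Ss0.
have aP i : (6 * a i <= P)%N.
  by have := node_le a i; rewrite /P; lia.
have Xr : 0 < X%:R :> F by rewrite ltr0n.
have xr : 0 < x%:R :> F by rewrite ltr0n.
have sN : Num.sqrt N%:R = x%:R :> F by rewrite natrX sqrtr_sqr ger0_norm ?ler0n.
have s2x i : s i <= 2 * x%:R.
  rewrite -natrM -[leRHS]ger0_norm ?ler0n // -sqrtr_sqr ler_wsqrtr // -natrX ler_nat.
  by have := aP i; move: PN; rewrite /N; lia.
have s0 i : 0 <= s i by exact: sqrtr_ge0.
have SX i : `|S i - X%:R| <= (a i)%:R / X%:R.
  have XS : X%:R <= S i.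
    by rewrite -[leLHS]ger0_norm ?ler0n // -sqrtr_sqr ler_wsqrtr // -natrX ler_nat leq_addr.
  rewrite ger0_norm ?subr_ge0 // lerBlDl.
  have pos : 0 <= X%:R + (a i)%:R / X%:R :> F by rewrite addr_ge0 ?divr_ge0 ?ler0n.
  rewrite -[leRHS]ger0_norm // -sqrtr_sqr ler_wsqrtr // natrD natrX.
  have -> : (X%:R + (a i)%:R / X%:R) ^+ 2 =
     X%:R ^+ 2 + (a i)%:R + ((a i)%:R + ((a i)%:R / X%:R) ^+ 2) :> F.
    by field; rewrite gt_eqF.
  by rewrite lerDl addr_ge0 ?ler0n // sqr_ge0.
pose Sum := \sum_i S i * s i * r i.
have Sum1 : 1 <= `|Sum|.
  apply: norm_intr_ge1 => //; apply: rpred_sum => i _.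
  by rewrite SsE rpredM ?rint // rpred_nat.
(* Each [S i] is replaced by [X]: the main term is the small form, controlled by [Xk], and the
   correction, at most [a i / X] per factor, is controlled by [kX]. *)
have SumE : Sum = X%:R * \sum_i s i * r i + \sum_i (S i - X%:R) * (s i * r i).
  rewrite mulr_sumr -big_split; apply: eq_bigr => i _ /=; ring.
have CP : C%:R ^+ k.+1 <= P%:R ^+ k.+1 :> F.
  by rewrite lerXn2r ?nnegrE ?ler0n // ler_nat leq_addr.
have part1 : `|X%:R * \sum_i s i * r i| <= 2^-1.
  rewrite normrM gtr0_norm //; apply: le_trans (ler_wpM2l (ltW Xr) rsmall) _.
  rewrite sN; apply: (@le_trans _ _ (X%:R * (x%:R * P%:R ^+ k.+1 / N%:R ^+ (2 * k)))).
    apply: ler_wpM2l; first exact: ltW.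
    apply: ler_wpM2r; first by rewrite invr_ge0 exprn_ge0 ?ler0n.
    by apply: ler_wpM2l; first exact: ltW.
  have Nk : 0 < N%:R ^+ (2 * k) :> F by rewrite exprn_gt0 // ltr0n; apply: leq_trans xN.
  rewrite !mulrA ler_pdivrMr // [2^-1 * _]mulrC ler_pdivlMr // [_ * 2]mulrC -!natrX -!natrM ler_nat.
  by have -> : (N ^ (2 * k) = x ^ (4 * k))%N by rewrite /N -expnM; congr (_ ^ _)%N; lia.
have part2 : `|\sum_i (S i - X%:R) * (s i * r i)| < 2^-1.
  have : `|\sum_i (S i - X%:R) * (s i * r i)| <=
      \sum_(i < 3) (P%:R / 3 * P%:R ^+ k.+1 * x%:R ^+ (2 * k).+1 / X%:R).
    apply: le_trans (ler_norm_sum _ _ _) _; apply: ler_sum => i _.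
    rewrite !normrM (ger0_norm (s0 i)).
    apply: (@le_trans _ _ ((a i)%:R / X%:R * (2 * x%:R * (C%:R ^+ k.+1 * N%:R ^+ k)))).
      by apply: ler_pM; rewrite ?mulr_ge0 //; apply: ler_pM.
    have -> : (a i)%:R / X%:R * (2 * x%:R * (C%:R ^+ k.+1 * N%:R ^+ k)) =
        (2 * (a i)%:R) * C%:R ^+ k.+1 * (x%:R * N%:R ^+ k) / X%:R :> F by ring.
    have -> : x%:R ^+ (2 * k).+1 = x%:R * N%:R ^+ k :> F.
      by rewrite exprS exprM natrX.
    apply: ler_wpM2r; first by rewrite invr_ge0 ltW.
    apply: ler_wpM2r; first by rewrite mulr_ge0 ?exprn_ge0 ?ler0n.
    apply: ler_pM; rewrite ?mulr_ge0 ?exprn_ge0 ?ler0n //.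
    rewrite ler_pdivlMr // -!natrM ler_nat.
    by have := aP i; lia.
  move/le_lt_trans; apply; rewrite sumr_const card_ord.
  have -> : (P%:R / 3 * P%:R ^+ k.+1 * x%:R ^+ (2 * k).+1 / X%:R) *+ 3 =
     P%:R ^+ k.+2 * x%:R ^+ (2 * k).+1 / X%:R :> F.
    by rewrite [P%:R ^+ k.+2]exprS -mulr_natr; field; rewrite gt_eqF.
  rewrite ltr_pdivrMr // [2^-1 * _]mulrC ltr_pdivlMr // -!natrX -!natrM ltr_nat.
  by rewrite mulnC.
move: Sum1; rewrite SumE leNgt => /negP; apply.
apply: le_lt_trans (ler_normD _ _) _.
by apply: lt_le_trans (ler_ltD part1 part2) _; lra.
Qed.

(** * Polygonal numbers *)

Definition twice_polygonal (l r : int) : int := (l - 2) * r ^+ 2 - (l - 4) * r.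

Lemma polygonal_eq (m n l r s : int) :
  m%:~R * polygonal l r = n%:~R * polygonal l s ->
  m * twice_polygonal l r = n * twice_polygonal l s.
Proof.
have i2 : 2%:R^-1 != 0 :> rat by [].
have E x : polygonal l x = (twice_polygonal l x)%:~R / 2%:R by [].
rewrite !E !mulrA => /(mulIf i2) H.
by apply: (@intr_inj rat); rewrite [LHS]intrM [RHS]intrM; exact: H.
Qed.

(** Divisibility of the squares gives [s] dividing [r], so [m] is the square of the quotient. *)
Lemma square_not_squarefree (m r s : int) : 1 < m -> 0 < s ->
  r ^+ 2 = m * s ^+ 2 -> ~ squarefree m.
Proof.
move=> m1 s0 rs sf; have : (s ^+ 2 %| r ^+ 2)%Z by rewrite rs dvdz_mull.
rewrite dvdz_pexp2r // => /dvdzP[q qE].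
have mq : m = q ^+ 2.
  have s2 : s ^+ 2 != 0 by rewrite expf_neq0 // gt_eqF.
  by apply: (mulIf s2); rewrite -rs qE exprMn.
have q1 : `|q| = 1 by apply: sf; rewrite mq.
by move: m1; rewrite mq (eqP (_ : q ^+ 2 == 1)) // sqr_norm_eq1 q1.
Qed.

Definition completion (l r : int) : int := 2 * (l - 2) * r - (l - 4).

Lemma completion_sqr (l r : int) :
  completion l r ^+ 2 = 4 * (l - 2) * twice_polygonal l r + (l - 4) ^+ 2.
Proof. by rewrite /completion /twice_polygonal; ring. Qed.

Lemma le_completion (l r : int) : 3 <= l -> 0 < r -> r <= completion l r.
Proof. by rewrite /completion => l3 r0; nia. Qed.

Lemma finite_int_triples (B : nat) : finite_set
  [set p : int * int * int | [/\ 0 < p.1.1 <= B%:Z, 0 < p.1.2 <= B%:Z & 0 < p.2 <= B%:Z]].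
Proof.
apply: (@sub_finite_set _ _ ((fun q : 'I_B.+1 * 'I_B.+1 * 'I_B.+1 =>
  ((q.1.1 : nat)%:Z, (q.1.2 : nat)%:Z, (q.2 : nat)%:Z)) @` setT)%classic).
  move=> [[r s] t] /= [/andP[r0 rB] /andP[s0 sB] /andP[t0 tB]].
  have ex (x : int) : 0 < x -> x <= B%:Z -> exists y : 'I_B.+1, (y : nat)%:Z = x.
    move=> x0 xB; have xn : (`|x| < B.+1)%N by lia.
    by exists (Ordinal xn) => /=; lia.
  have [r' <-] := ex r r0 rB; have [s' <-] := ex s s0 sB; have [t' <-] := ex t t0 tB.
  by exists (r', s', t').
by apply: finite_image; exact: finite_finset.
Qed.

Lemma sqr_completion_mul (l m r s : int) :
  twice_polygonal l r = m * twice_polygonal l s ->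
  completion l r ^+ 2 + (m - 1) * (l - 4) ^+ 2 = m * completion l s ^+ 2.
Proof. by move=> rs; rewrite !completion_sqr rs; ring. Qed.

Lemma polygonal_triples_bounded (l m n : int) : 3 <= l -> l != 4 -> 1 < n -> n < m ->
  exists B : nat, forall r s t : int, 0 < r -> 0 < s -> 0 < t ->
    twice_polygonal l r = m * twice_polygonal l s ->
    twice_polygonal l r = n * twice_polygonal l t ->
    [/\ r <= B%:Z, s <= B%:Z & t <= B%:Z].
Proof.
move=> l3 l4 n1 nm.
(* The offsets 3 and 2 record [m >= 3] and [n >= 2], so that [m - 1] and [n - 1] become naturals
   without subtraction. *)
have [m' Em] : exists m', m = m'.+3%:Z by exists (`|m| - 3)%N; lia.
have [n' En] : exists n', n = n'.+2%:Z by exists (`|n| - 2)%N; lia.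
have [c c0 Ec] : exists2 c, (0 < c)%N & (l - 4) ^+ 2 = c%:Z.
  exists (`|l - 4| ^ 2)%N; first by rewrite expn_gt0 absz_gt0 subr_eq0 l4.
  by rewrite -mulnn PoszM -normrM expr2 ger0_norm // -expr2 sqr_ge0.
pose a (i : 'I_3) := nth 0%N [:: 0; m'.+2 * c; n'.+1 * c]%N i.
pose b (i : 'I_3) := nth 0%N [:: 1; m'.+3; n'.+2]%N i.
have nm' : (n' < m'.+1)%N by lia.
have a_inj : injective a.
  move=> [[|[|[|i]]] hi] [[|[|[|j]]] hj] //= e; apply: val_inj => //=;
    move: e; rewrite /a /=; nia.
have [B XB] := @simultaneous_pell_bounded realalg a b a_inj.
have nat_completion x : 0 < x -> exists y : nat, completion l x = y%:Z.
  by move=> x0; exists `|completion l x|%N; have := le_completion l3 x0; lia.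
(* The summand [B] bounds [x]; the others bound [x ^ 2] plus its shift, which equals [m * y ^ 2] or
   [n * z ^ 2] and hence dominates [y] or [z]. *)
exists (B + B ^ 2 + m'.+3 * c + n'.+2 * c)%N => r s t r0 s0 t0 rs rt.
have {}rs := sqr_completion_mul rs; have {}rt := sqr_completion_mul rt.
have [x Ex] := nat_completion r r0; have [y Ey] := nat_completion s s0.
have [z Ez] := nat_completion t t0.
have lr := le_completion l3 r0; have ls := le_completion l3 s0.
have lt := le_completion l3 t0.
rewrite Ex in rs rt lr; rewrite Ey in rs ls; rewrite Ez in rt lt.
rewrite Em Ec in rs; rewrite En Ec in rt.
have {}rs : (x ^ 2 + m'.+2 * c = m'.+3 * y ^ 2)%N.
  rewrite -!mulnn; move: rs; rewrite !expr2; lia.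
have {}rt : (x ^ 2 + n'.+1 * c = n'.+2 * z ^ 2)%N.
  rewrite -!mulnn; move: rt; rewrite !expr2; lia.
have xB : (x <= B)%N.
  apply: (XB x (fun i => nth 0%N [:: x; y; z] i)).
  by move=> [[|[|[|i]]] hi] //=; rewrite /a /b /= ?rs ?rt // mul1n addn0.
have xB2 : (x ^ 2 <= B ^ 2)%N by rewrite leq_exp2r.
have yb : (y <= m'.+3 * y ^ 2)%N by nia.
have zb : (z <= n'.+2 * z ^ 2)%N by nia.
by split; lia.
Qed.

Theorem theorem6 (l m n : int) (hl : 3 <= l) (hn : 1 < n) (hmn : n < m)
    (hsf : l = 4 -> squarefree m \/ squarefree n) :
  finite_set [set p : int * int * int | let: (r, s, t) := p in
    [/\ 0 < r, 0 < s, 0 < t,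
        polygonal l r = m%:~R * polygonal l s &
        m%:~R * polygonal l s = n%:~R * polygonal l t]].
Proof.
have eqs r s t : polygonal l r = m%:~R * polygonal l s ->
    m%:~R * polygonal l s = n%:~R * polygonal l t ->
    twice_polygonal l r = m * twice_polygonal l s /\
    twice_polygonal l r = n * twice_polygonal l t.
  have red k x : polygonal l r = k%:~R * polygonal l x ->
      twice_polygonal l r = k * twice_polygonal l x.
    by move=> e; rewrite -[LHS]mul1r; apply: polygonal_eq; rewrite mul1r.
  by move=> rs st; split; apply: red; rewrite ?rs.
have [l4|l4] := eqVneq l 4.
  (* For [l = 4] the equations read [r ^+ 2 = m * s ^+ 2 = n * t ^+ 2], making both [m] and [n]
     squares above 1, so there is no solution. *)
  apply: (@sub_finite_set _ _ set0) => // -[[r s] t] [_ s0 t0 rs st].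
  have [{}rs rt] := eqs _ _ _ rs st.
  have sq k x : twice_polygonal l r = k * twice_polygonal l x -> r ^+ 2 = k * x ^+ 2.
    by rewrite /twice_polygonal l4; lia.
  case: (hsf l4).
    exact: square_not_squarefree (lt_trans hn hmn) s0 (sq _ _ rs).
  exact: square_not_squarefree hn t0 (sq _ _ rt).
have [B HB] := polygonal_triples_bounded hl l4 hn hmn.
apply: sub_finite_set (finite_int_triples B) => -[[r s] t] [r0 s0 t0 rs st].
have [{}rs rt] := eqs _ _ _ rs st.
by have [rB sB tB] := HB r s t r0 s0 t0 rs rt; split; apply/andP.
Qed.
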